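(* Let $n\ge 2$, let $\alpha=(\alpha_1,\dots,\alpha_n)\in\mathbb{C}^n\setminus\{0\}$ with $|\alpha_1|=\cdots=|\alpha_n|\neq 1$, and let $M_\alpha=(\mathbb{C}^n\setminus\{0\})/\sim$ be the Hopf manifold, where $(z_1,\dots,z_n)\sim(\alpha_1z_1,\dots,\alpha_nz_n)$. Let $\omega_H$ be the Hermitian metric on $M_\alpha$ given by $$\omega_H=\frac{\delta_{ij}}{r^2}\sqrt{-1}\,dz_i\wedge d\overline{z}_j,\qquad r^2=\sum_{j=1}^n|z_j|^2.$$ Then the metrics $\omega(t):=\omega_H-t\,\mathrm{Ric}(\omega_H)$ on $M_\alpha$ give a solution of the Chern-Ricci flow $\frac{\partial}{\partial t}\omega=-\mathrm{Ric}(\omega)$ on the maximal existence interval $[0,1/n)$. As $t\to T=1/n$, the limiting nonnegative $(1,1)$ form $\omega_T$ is given by $$\omega_T=\frac{\overline{z}_iz_j}{r^4}\sqrt{-1}\,dz_i\wedge d\overline{z}_j .$$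
   Context: Summation over repeated indices $i,j=1,\dots,n$ is understood. A Hermitian metric $g$ is identified with its associated real positive $(1,1)$ form $\omega=\sqrt{-1}\,g_{i\overline{j}}\,dz_i\wedge d\overline{z}_j$. The Chern-Ricci form of $\omega$ is $\mathrm{Ric}(\omega)=-\sqrt{-1}\partial\overline{\partial}\log\det g$ (locally). The maximal existence interval is the largest interval $[0,T)$ on which a smooth solution by Hermitian metrics with the given initial metric exists. *)

(* Defs.v *)
From HB Require Import structures.
From mathcomp Require Import all_boot all_order all_algebra.
From mathcomp Require Import all_classical all_reals all_analysis.
From mathcomp Require Import complex.
From mathcomp Require Import ring.
Set Implicit Arguments.
Unset Strict Implicit.
Unset Printing Implicit Defensive.
Import Order.TTheory GRing.Theory Num.Theory.
Import numFieldNormedType.Exports.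
Local Open Scope complex_scope.
Local Open Scope classical_set_scope.
Local Open Scope quotient_scope.
Local Open Scope ring_scope.

(* The topology of R[i] is that of its modulus. *)
HB.instance Definition _ (R : realType) :=
  PseudoPointedMetric.copy R[i] (R[i] : numClosedFieldType)^o.
HB.instance Definition _ (R : realType) := GRing.ComAlgebra.copy R[i] R[i]^o.
HB.instance Definition _ (R : realType) := Vector.copy R[i] R[i]^o.
HB.instance Definition _ (R : realType) :=
  NormedModule.copy R[i] (R[i] : numClosedFieldType)^o.

Section Calculus.
Variables (R : realType) (n : nat).
Local Notation C := R[i].
Local Notation Cn := 'rV[R[i]]_n.
Implicit Types (I : set R) (U : set Cn) (T : \bar R).

Definition diffquot (f : R -> C) (t h : R) : C := (f (t + h) - f t) / h%:C.

(* Only increments h with t + h in I are used, so that the derivative at an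
   endpoint of an interval I is one-sided. *)
Definition rderivable I (f : R -> C) (t : R) : Prop :=
  cvg (diffquot f t h @[h --> within [set h | I (t + h)] 0^']).

Definition rderive I (f : R -> C) (t : R) : C :=
  lim (diffquot f t h @[h --> within [set h | I (t + h)] 0^']).

Definition dirder (v : Cn) (f : Cn -> C) (z : Cn) : C :=
  rderive setT (fun s => f (z + s%:C *: v)) 0.

Definition ebase (j : 'I_n) : Cn := delta_mx 0 j.

(* With z_j = x_j + i y_j:  d/dz_j = (d/dx_j - i d/dy_j) / 2  and
   d/dzbar_j = (d/dx_j + i d/dy_j) / 2. *)
Definition dz (j : 'I_n) (f : Cn -> C) (z : Cn) : C :=
  (dirder (ebase j) f z - 'i%C * dirder ('i%C *: ebase j) f z) / 2.

Definition dzbar (j : 'I_n) (f : Cn -> C) (z : Cn) : C :=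
  (dirder (ebase j) f z + 'i%C * dirder ('i%C *: ebase j) f z) / 2.

Definition iter_dirder (vs : seq Cn) (f : Cn -> C) : Cn -> C :=
  foldr dirder f vs.

Definition smooth_on U (f : Cn -> C) : Prop :=
  forall vs : seq Cn,
    {within U, continuous (iter_dirder vs f)} /\
    forall v z, U z -> rderivable setT (fun s => iter_dirder vs f (z + s%:C *: v)) 0.

(* None is the derivative in time, Some v the derivative along v in space. *)
Definition stder I (d : option Cn) (f : R -> Cn -> C) : R -> Cn -> C :=
  if d is Some v then fun t => dirder v (f t)
  else fun t z => rderive I (f ^~ z) t.

Definition iter_stder I (ds : seq (option Cn)) (f : R -> Cn -> C) :=
  foldr (stder I) f ds.

Definition st_smooth_on I U (f : R -> Cn -> C) : Prop :=
  forall ds : seq (option Cn), let F := iter_stder I ds f in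
    [/\ {within I `*` U, continuous (fun p : R * Cn => F p.1 p.2)},
        forall t z, I t -> U z -> rderivable I (F ^~ z) t &
        forall v t z, I t -> U z -> rderivable setT (fun s => F t (z + s%:C *: v)) 0].

Definition time_interval T : set R := [set t | 0 <= t /\ (t%:E < T)%E].

Definition adjmx m p (A : 'M[C]_(m, p)) : 'M[C]_(p, m) := map_mx Num.conj A^T.

Definition posdefmx (A : 'M[C]_n) : Prop :=
  A = adjmx A /\ forall v : Cn, v != 0 -> 0 < (v *m A *m adjmx v) 0 0.

Definition possemidefmx (A : 'M[C]_n) : Prop :=
  A = adjmx A /\ forall v : Cn, 0 <= (v *m A *m adjmx v) 0 0.

End Calculus.

(* An n-dimensional complex structure on the set [carrier].  Charts are given
   by their inverses: [par c] maps the open set [dom c] of C^n bijectively onto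
   a coordinate domain of the manifold.  The topology is the one induced by the
   charts; separation axioms are not required, as nothing below uses them. *)
Record complexManifold (R : realType) (n : nat) := ComplexManifold {
  carrier :> Type;
  chart : Type;
  dom : chart -> set 'rV[R[i]]_n;
  par : chart -> 'rV[R[i]]_n -> carrier;
  trans c d z := xget 0 [set w | dom d w /\ par d w = par c z];
  overlap c d := [set z | dom c z /\ exists2 w, dom d w & par d w = par c z];
  dom_open : forall c, open (dom c);
  par_inj : forall c z w, dom c z -> dom c w -> par c z = par c w -> z = w;
  par_cover : forall p, exists c z, dom c z /\ par c z = p;
  overlap_open : forall c d, open (overlap c d);
  trans_holo : forall c d z, overlap c d z -> differentiable (trans c d) z }.

Section ChernRicci.
Variables (R : realType) (n : nat) (M : complexManifold R n).
Local Notation C := R[i].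
Local Notation Cn := 'rV[R[i]]_n.

(* The form sqrt(-1) g_{i jbar} dz_i /\ dzbar_j is represented by its
   coefficient matrices (g_{i jbar}), one matrix-valued function for each chart;
   values outside of [dom c] are irrelevant. *)
Definition coefs := chart M -> Cn -> 'M[C]_n.

(* 'J f z has entries ('J f z) i k = d f_k / d z_i. *)
Definition is_form11 (g : coefs) : Prop :=
  forall c d z, overlap c d z ->
    let J := 'J (trans c d) z in
    g c z = J *m g d (trans c d z) *m adjmx J.

Definition smooth_form (g : coefs) : Prop :=
  is_form11 g /\ forall c i j, smooth_on (dom c) (fun z => g c z i j).

Definition hermitian_metric (g : coefs) : Prop :=
  smooth_form g /\ forall c z, dom c z -> posdefmx (g c z).

Definition nonneg_form (g : coefs) : Prop :=
  smooth_form g /\ forall c z, dom c z -> possemidefmx (g c z).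

Definition chern_ricci (g : coefs) : coefs := fun c z =>
  \matrix_(i, j) - dz i (dzbar j (fun w => (ln (complex.Re (\det (g c w))))%:C)) z.

Definition chern_ricci_flow (g0 : coefs) (T : \bar R) (g : R -> coefs) : Prop :=
  let I := time_interval T in
  [/\ forall t, I t -> hermitian_metric (g t),
      forall c i j, st_smooth_on I (dom c) (fun t z => g t c z i j),
      forall t c z i j, I t -> dom c z ->
        rderive I (fun s => g s c z i j) t = - chern_ricci (g t) c z i j &
      forall c z, dom c z -> g 0 c z = g0 c z].

Definition is_max_existence_time (g0 : coefs) (T : \bar R) : Prop :=
  [/\ (0 < T)%E, exists g, chern_ricci_flow g0 T g &
      forall T' g, chern_ricci_flow g0 T' g -> (T' <= T)%E].

(* Convergence as t increases to T, uniform on compact subsets of the charts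
   together with all derivatives. *)
Definition smooth_cvg_left (g : R -> coefs) (T : R) (gT : coefs) : Prop :=
  forall c i j (vs : seq Cn) (K : set Cn) (e : R),
    compact K -> K `<=` dom c -> 0 < e ->
    \forall t \near T^'-, forall z, K z ->
      `| iter_dirder vs (fun w => g t c w i j) z
         - iter_dirder vs (fun w => gT c w i j) z | < e%:C.

End ChernRicci.

Lemma near_differentiable (K : numFieldType) (V W : normedModType K)
    (f g : V -> W) (x : V) :
  {near x, f =1 g} -> differentiable g x -> differentiable f x.
Proof.
move=> fg dg; rewrite -(subrK g f); apply: differentiableD => //.
set h := f - g.
have hx : h x = 0 by rewrite /h !fctE (nbhs_singleton fg) subrr.
have hE : h \o shift x = cst (h x) + \0 +o_ 0 id.
  apply/eqaddoP => _/posnumP[e]; rewrite hx.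
  have fg0 : \forall y \near (0 : V), f (y + x) = g (y + x).
    by have := fg; rewrite (near_shift (0 : V)) subr0.
  near=> y; rewrite !fctE /= /h !fctE addr0 subr0.
  have -> : f (y + x) = g (y + x) by near: y.
  by rewrite subrr normr0 mulr_ge0.
have c0 : continuous (\0 : V -> W) by exact: cst_continuous.
have h0 := @diff_unique _ _ _ h \0 x c0 hE.
by apply/diff_locallyP; rewrite h0.
Unshelve. all: by end_near. Qed.

Section Hopf.
Variables (R : realType) (n : nat) (alpha : 'rV[R[i]]_n).
Local Notation C := R[i].
Local Notation Cn := 'rV[R[i]]_n.

Definition hopf_param : Prop :=
  [/\ alpha != 0, forall i j, `|alpha 0 i| = `|alpha 0 j| &
      forall i, `|alpha 0 i| != 1].

Hypothesis halpha : hopf_param.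

Definition alpha_act (k : int) (z : Cn) : Cn := \row_i (alpha 0 i ^ k * z 0 i).

Definition punctured := {z : Cn | z != 0}.

Definition hopf_rel (z w : punctured) : bool :=
  `[< exists k : int, sval w = alpha_act k (sval z) >].

Lemma alpha_neq0 i : alpha 0 i != 0.
Proof.
case: halpha => a0 eqa _; apply: contraNneq a0 => ai0.
apply/eqP/rowP => j; rewrite mxE; apply/eqP; rewrite -normr_eq0 (eqa j i).
by rewrite ai0 normr0.
Qed.

Lemma alpha_act0 z : alpha_act 0 z = z.
Proof. by apply/rowP => i; rewrite mxE expr0z mul1r. Qed.

Lemma alpha_actD k l z : alpha_act k (alpha_act l z) = alpha_act (k + l) z.
Proof.
by apply/rowP => i; rewrite !mxE expfzDr ?alpha_neq0// mulrA.
Qed.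

Lemma hopf_rel_refl : reflexive hopf_rel.
Proof. by move=> z; apply/asboolP; exists 0; rewrite alpha_act0. Qed.

Lemma hopf_rel_sym : symmetric hopf_rel.
Proof.
suff H z w : hopf_rel z w -> hopf_rel w z by move=> z w; apply/idP/idP; exact: H.
move=> /asboolP[k e]; apply/asboolP; exists (- k).
by rewrite e alpha_actD addNr alpha_act0.
Qed.

Lemma hopf_rel_trans : transitive hopf_rel.
Proof.
move=> w z u /asboolP[k ew] /asboolP[l eu]; apply/asboolP; exists (l + k).
by rewrite eu ew alpha_actD.
Qed.

Definition hopf_equiv := EquivRel hopf_rel hopf_rel_refl hopf_rel_sym hopf_rel_trans.

Definition hopf_space : Type := {eq_quot hopf_equiv}.

(* The class of z; the value at z = 0 is irrelevant. *)
Definition hopf_proj (z : Cn) : hopf_space :=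
  \pi_{eq_quot hopf_equiv}
    (insubd (exist (fun z : Cn => z != 0) alpha (let: And3 h _ _ := halpha in h)) z).

Lemma hopf_projP (z w : Cn) : z != 0 -> w != 0 ->
  hopf_proj z = hopf_proj w <-> exists k : int, w = alpha_act k z.
Proof.
move=> z0 w0; split=> [/eqquotP/asboolP[k]|[k e]].
  by rewrite -!/(val _) !insubdK// => e; exists k.
by apply/eqquotP/asboolP; exists k; rewrite -!/(val _) !insubdK.
Qed.

Lemma hopf_proj_surj (p : hopf_space) : exists2 z, z != 0 & hopf_proj z = p.
Proof.
exists (sval (repr p)); first exact: (svalP (repr p)).
by rewrite /hopf_proj -/(val _) valKd reprK.
Qed.

(* The charts of M_alpha are the local inverses of the projection. *)
Definition hopf_chart : Type :=
  {U : set Cn | [/\ open U, forall z, U z -> z != 0 &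
    forall z w, U z -> U w -> hopf_proj z = hopf_proj w -> z = w]}.

Definition hopf_dom (c : hopf_chart) : set Cn := sval c.

Lemma alpha_act_diag k z :
  alpha_act k z = mulmxr (diag_mx (\row_i alpha 0 i ^ k)) z.
Proof. by apply/rowP => i; rewrite /mulmxr mul_mx_diag !mxE mulrC. Qed.

Lemma alpha_index : exists i : 'I_n, true.
Proof.
case: halpha => a0 _ _; move: alpha a0 => /=; case: n => [|m] a; last by exists ord0.
by rewrite thinmx0 eqxx.
Qed.

Lemma norm_alpha_act k z i : `|alpha_act k z| = `|alpha 0 i| ^ k * `|z|.
Proof.
case: halpha => _ eqa _.
have a_ge0 : 0 <= `|alpha 0 i| ^ k by rewrite exprz_ge0.
suff -> : `|alpha_act k z| = `|(`|alpha 0 i| ^ k) *: z|.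
  by rewrite normrZ ger0_norm.
rewrite /Num.norm/= !mx_normE; congr (_%:num); apply: eq_bigr => j _.
apply/val_inj => /=; rewrite !mxE !normrM (ger0_norm a_ge0) (ord1 j.1) (eqa i j.2).
by case: k {a_ge0} => k; rewrite ?NegzE -?exprnN ?normfV ?exprnP -?exprnP normrX.
Qed.

Lemma linear_alpha_act k : linear (alpha_act k).
Proof. by move=> a u v; rewrite !alpha_act_diag linearP. Qed.

HB.instance Definition _ k :=
  GRing.isLinear.Build C Cn Cn *:%R (alpha_act k) (linear_alpha_act k).

Lemma continuous_alpha_act k : continuous (alpha_act k).
Proof.
have [i _] := alpha_index.
apply: bounded_linear_continuous; apply/linear_boundedP.
near=> r => z; rewrite (norm_alpha_act k z i) ler_wpM2r//.
near: r; apply: nbhs_pinfty_ge.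
by rewrite ger0_real// exprz_ge0.
Unshelve. all: by end_near. Qed.

Lemma differentiable_alpha_act k z : differentiable (alpha_act k) z.
Proof. by apply: linear_differentiable; exact: continuous_alpha_act. Qed.


Lemma hopf_dom_open c : open (hopf_dom c).
Proof. by have [] := svalP c. Qed.

Lemma hopf_dom_neq0 c z : hopf_dom c z -> z != 0.
Proof. by have [_ + _] := svalP c; apply. Qed.

Lemma hopf_dom_inj c z w :
  hopf_dom c z -> hopf_dom c w -> hopf_proj z = hopf_proj w -> z = w.
Proof. by have [_ _] := svalP c; apply. Qed.

Lemma hopf_injective_ball z : z != 0 -> exists2 e : C, 0 < e &
  (forall w, ball z e w -> w != 0) /\
  (forall w w', ball z e w -> ball z e w' -> hopf_proj w = hopf_proj w' -> w = w').
Proof.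
move=> z0; have [i _] := alpha_index.
have a0 : 0 < `|alpha 0 i| by rewrite normr_gt0 alpha_neq0.
have z_gt0 : 0 < `|z| by rewrite normr_gt0.
have [q q1 hq] : exists2 q : C, 1 < q &
    forall k : int, k != 0 -> q <= `|alpha 0 i| ^ k \/ q <= `|alpha 0 i| ^ (- k).
  have H (q : C) : 1 < q -> forall k : int, k != 0 -> q <= q ^ k \/ q <= q ^ (- k).
    move=> q1 [[//|m]|m] _; [left|right]; last rewrite NegzE opprK.
      by apply: ler_eXnr => //; exact: ltW.
    by apply: ler_eXnr => //; exact: ltW.
  case: halpha => _ _ /(_ i) a1.
  have /orP[lt1|gt1] : (`|alpha 0 i| < 1) || (1 < `|alpha 0 i|).
    by rewrite -real_neqr_lt ?normr_real ?real1.
  - exists `|alpha 0 i|^-1 => [|k k0]; first by rewrite invf_gt1.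
    have [] := H `|alpha 0 i|^-1 _ k k0; first by rewrite invf_gt1.
      by rewrite exprz_inv; right.
    by rewrite exprz_inv opprK; left.
  - by exists `|alpha 0 i| => // k k0; exact: H.
have q1p : 0 < q + 1 by rewrite addr_gt0// (lt_trans _ q1).
have e0 : 0 < `|z| * (q - 1) / (q + 1).
  by rewrite divr_gt0// mulr_gt0// subr_gt0.
set e := _ / _ in e0 *; exists e => //.
have q0 : 0 < q by rewrite (lt_trans _ q1).
have eq1 : `|z| + e = q * (`|z| - e).
  by rewrite /e; field; rewrite gt_eqF.
have eq2 : 0 < `|z| - e.
  rewrite (_ : _ - _ = 2 * `|z| / (q + 1)); last by rewrite /e; field; rewrite gt_eqF.
  by rewrite divr_gt0// mulr_gt0.
have lo w : ball z e w -> `|z| - e < `|w|.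
  rewrite -ball_normE /= => zw; rewrite ltrBlDr.
  by rewrite -{1}(subrK w z) (le_lt_trans (ler_normD _ _))// addrC ltrD2l.
have hi w : ball z e w -> `|w| < `|z| + e.
  rewrite -ball_normE /= distrC => zw.
  by rewrite -{1}(subrK z w) (le_lt_trans (ler_normD _ _))// addrC ltrD2l.
have nz w : ball z e w -> w != 0.
  by move=> /lo; rewrite -normr_gt0; exact: lt_trans.
have lt_q w w' : ball z e w -> ball z e w' -> `|w'| < q * `|w|.
  move=> /lo wl /hi /lt_trans; apply; rewrite eq1.
  by rewrite ltr_pM2l.
split=> // w w' bw bw' /hopf_projP[||k w'E]; [exact: nz|exact: nz|].
have [k0|k0] := eqVneq k 0; first by rewrite w'E k0 alpha_act0.
exfalso; have [h|h] := hq k k0.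
  have := lt_q w w' bw bw'; rewrite w'E (norm_alpha_act _ _ i).
  rewrite ltr_pM2r ?normr_gt0 ?nz// => /lt_le_trans/(_ h).
  by rewrite ltxx.
have wE : w = alpha_act (- k) w' by rewrite w'E alpha_actD addNr alpha_act0.
have := lt_q w' w bw' bw; rewrite {1}wE (norm_alpha_act _ _ i).
rewrite ltr_pM2r ?normr_gt0 ?nz// => /lt_le_trans/(_ h).
by rewrite ltxx.
Qed.

Lemma hopf_cover p : exists c z, hopf_dom c z /\ hopf_proj z = p.
Proof.
have [z z0 <-] := hopf_proj_surj p.
have [e e0 [h1 h2]] := hopf_injective_ball z0.
exists (exist _ (ball z e) (And3 (ball_open _ _) h1 h2)), z; split=> //.
exact: ballxx.
Qed.

Lemma hopf_overlap c d z w :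
  hopf_dom c z -> hopf_dom d w -> hopf_proj w = hopf_proj z ->
  exists k, \forall z' \near z, [/\ hopf_dom c z', hopf_dom d (alpha_act k z') &
    hopf_proj (alpha_act k z') = hopf_proj z'].
Proof.
move=> cz dw e; have z0 := hopf_dom_neq0 cz; have w0 := hopf_dom_neq0 dw.
have [k wE] : exists k, w = alpha_act k z by apply/hopf_projP.
exists k; near=> z'.
have cz' : hopf_dom c z'.
  by near: z'; apply: open_nbhs_nbhs; split=> //; exact: hopf_dom_open.
have dz' : hopf_dom d (alpha_act k z').
  near: z'; apply: (@continuous_alpha_act k z (hopf_dom d)).
  by rewrite -wE; apply: open_nbhs_nbhs; split=> //; exact: hopf_dom_open.
split=> //; apply/esym/hopf_projP; [exact: hopf_dom_neq0 cz'|exact: hopf_dom_neq0 dz'|].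
by exists k.
Unshelve. all: by end_near. Qed.

Let overlap c d :=
  [set z | hopf_dom c z /\ exists2 w, hopf_dom d w & hopf_proj w = hopf_proj z].

Lemma hopf_overlap_open c d : open (overlap c d).
Proof.
rewrite openE => z [cz [w dw e]].
have [k kP] := hopf_overlap cz dw e.
rewrite /interior; near=> z'.
have [] : [/\ hopf_dom c z', hopf_dom d (alpha_act k z') &
    hopf_proj (alpha_act k z') = hopf_proj z'] by near: z'.
by move=> cz' dz' e'; split=> //; exists (alpha_act k z').
Unshelve. all: by end_near. Qed.

Lemma hopf_trans_holo c d z : overlap c d z ->
  differentiable
    (fun z => xget 0 [set w | hopf_dom d w /\ hopf_proj w = hopf_proj z] : Cn) z.
Proof.
move=> [cz [w dw e]]; have [k kP] := hopf_overlap cz dw e.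
apply: (near_differentiable _ (differentiable_alpha_act k z)).
near=> z'.
have [_ dz' e'] : [/\ hopf_dom c z', hopf_dom d (alpha_act k z') &
    hopf_proj (alpha_act k z') = hopf_proj z'] by near: z'.
case: xgetP => [y _ [dy ye]|/(_ (alpha_act k z'))]; last by case.
by apply: (hopf_dom_inj dy dz'); rewrite ye.
Unshelve. all: by end_near. Qed.

Definition hopf_manifold : complexManifold R n :=
  ComplexManifold hopf_dom_open hopf_dom_inj hopf_cover
    hopf_overlap_open hopf_trans_holo.

End Hopf.

Section HopfForms.
Variables (R : realType) (n : nat) (alpha : 'rV[R[i]]_n).
Hypothesis halpha : hopf_param alpha.
Local Notation Cn := 'rV[R[i]]_n.

Definition rsq (z : Cn) : R[i] := \sum_j `|z 0 j| ^+ 2.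

Definition omegaH : coefs (hopf_manifold halpha) :=
  fun _ z => \matrix_(i, j) ((i == j)%:R / rsq z).

Definition omegaT : coefs (hopf_manifold halpha) :=
  fun _ z => \matrix_(i, j) ((z 0 i)^* * z 0 j / rsq z ^+ 2).

Definition hopf_flow (t : R) : coefs (hopf_manifold halpha) :=
  fun c z => omegaH c z - t%:C *: chern_ricci omegaH c z.

End HopfForms.

Arguments omegaH {R n alpha} halpha c z.
Arguments omegaT {R n alpha} halpha c z.
Arguments hopf_flow {R n alpha} halpha t c z.

(* Main.v *)
Require Import Defs.
From mathcomp Require Import all_boot all_order all_algebra.
From mathcomp Require Import all_classical all_reals all_analysis.
From mathcomp Require Import complex ring.
Set Implicit Arguments.
Unset Strict Implicit.
Unset Printing Implicit Defensive.
Import Order.TTheory GRing.Theory Num.Theory.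
Import numFieldNormedType.Exports.
Local Open Scope complex_scope.
Local Open Scope classical_set_scope.
Local Open Scope ring_scope.

(** The Chern-Ricci form depends on the metric only through its determinant, and
    det omega_H = r^(-2n).  Hence Ric(omega_H) = n i d dbar log r^2, which has
    coefficients n (delta_ij / r^2 - conj(z_i) z_j / r^4), and omega(t) has
    coefficients
      (1 - n t) delta_ij / r^2 + n t conj(z_i) z_j / r^4.
    This is a positive multiple of the identity plus a nonnegative matrix of rank
    one.  It is therefore positive definite for 0 <= t < 1/n, and by the rank-one
    determinant identity its determinant is r^(-2n) times a constant that depends
    on t only.  So Ric(omega(t)) = Ric(omega_H) ([chern_ricci_hopf_flow]), that is,
    the affine path omega(t) solves the flow ([hopf_flow_solution]).  As omega(t)
    is affine in t, so are all its space derivatives, and omega(t) - omega_T is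
    t - 1/n times a fixed smooth form; this gives the limit ([hopf_flow_cvg]).

    The time 1/n is maximal because omega_T is degenerate.  Let g be any solution
    that exists beyond T = 1/n, and let u(t) = log (det g(t) / det omega_H), a
    smooth function on M_alpha.  The flow equation reads
      dg/dt = i d dbar u(t) - Ric(omega_H),
    and integrating it over [0, T] gives g(T) = omega_T + i d dbar phi, with phi the
    integral of u.  As M_alpha is compact, phi has a maximum; there, i d dbar phi
    is nonpositive ([levi_form_max]), while omega_T vanishes on some vector v <> 0
    because n >= 2.  So g(T) would be nonpositive on v, a contradiction
    ([no_flow_beyond]).

    Derivation under the integral sign is avoided by letting phi be a Riemann sum
    of u: then i d dbar phi is a finite sum, the identity for g(T) holds up to a
    uniformly small error ([flow_riemann], from the mean value inequality and the
    uniform continuity of dg/dt on [0, T] times a compact set), and the error is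
    absorbed by the positive lower bound of g(T) on unit vectors
    ([quad_flow_lower]).  Compactness of M_alpha enters through the fact that
    every orbit of the dilation group meets a fixed compact shell of C^n
    ([fundamental_shell]).

    The smoothness predicates are stated through iterated directional derivatives.
    They are handled through the classes [Ck], which are defined by recursion on
    the order and closed under the algebraic operations, and the linearity of the
    directional derivative in the direction, needed to identify
    sum v_i conj(v_j) d_i dbar_j f with second derivatives along real lines,
    is derived from continuity of the first derivatives ([has_dirder_add]). *)

(** * The topology of the complex numbers *)

Section ComplexTopology.
Variable R : realType.
Local Notation C := R[i].
Local Notation Re := (@complex.Re R).
Local Notation Im := (@complex.Im R).

Lemma norm_real_complex (x : R) : `|x%:C| = `|x|%:C.
Proof. by rewrite normc_def /= expr0n addr0 sqrtr_sqr. Qed.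

Lemma norm_Re_le (z : C) : `|Re z| <= Re `|z|.
Proof. by have := normc_ge_Re z; rewrite normc_def lecR. Qed.

Lemma norm_i : `|'i%C : C| = 1.
Proof. by rewrite normc_def /= expr0n expr1n add0r sqrtr1. Qed.

Lemma norm_Im_le (z : C) : `|Im z| <= Re `|z|.
Proof.
by have := norm_Re_le (z * 'i%C); rewrite ReiNIm normrN normrM norm_i mulr1.
Qed.

Lemma gt0_complex_real (e : C) : 0 < e -> e = (Re e)%:C /\ 0 < Re e.
Proof. by case: e => a b; rewrite ltcE /= => /andP[/eqP -> ?]. Qed.

(** The neighbourhoods in C are given by complex radii; real radii suffice since
    a positive complex number is real. *)
Lemma cvgCP (T : Type) (F : set_system T) (FF : Filter F) (f : T -> C) (y : C) :
  f @ F --> y <-> forall e : R, 0 < e -> \forall t \near F, `|y - f t| < e%:C.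
Proof.
split=> [/cvgrPdist_lt fy e e0|fy]; first by apply: fy; rewrite ltcR.
by apply/cvgrPdist_lt => e /gt0_complex_real[-> e0]; exact: fy.
Qed.

Lemma continuous_real_complex : continuous (fun x : R => x%:C : C).
Proof.
move=> x; apply/cvgCP => e e0.
near=> y; rewrite -rmorphB/= norm_real_complex ltcR.
by near: y; exact: cvgr_dist_lt.
Unshelve. all: by end_near. Qed.

Lemma nbhs_complex (z : C) (e : R) : 0 < e -> \forall w \near z, `|z - w| < e%:C.
Proof. by move=> e0; exact: ((cvgCP (nbhs_filter z) id z).1 _ e e0). Qed.

Lemma ReD (x y : C) : Re (x + y) = Re x + Re y.
Proof. by case: x y => a b [c d]. Qed.

Lemma ImD (x y : C) : Im (x + y) = Im x + Im y.
Proof. by case: x y => a b [c d]. Qed.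

Lemma ReN (x : C) : Re (- x) = - Re x.
Proof. by case: x. Qed.

Lemma ImN (x : C) : Im (- x) = - Im x.
Proof. by case: x. Qed.

Lemma Re_rM (a : R) (x : C) : Re (a%:C * x) = a * Re x.
Proof. by case: x => b c; rewrite /= mul0r subr0. Qed.

Lemma Im_rM (a : R) (x : C) : Im (a%:C * x) = a * Im x.
Proof. by case: x => b c; rewrite /= mul0r addr0. Qed.

Lemma continuous_Re : continuous Re.
Proof.
move=> z; apply/(@cvgrPdist_lt R R _ _ (nbhs_filter z)) => e e0.
apply: filterS (nbhs_complex z e0) => w /= zw.
rewrite -raddfB/= (le_lt_trans (norm_Re_le _))//.
by rewrite -ltcR RRe_real ?normr_real.
Qed.

Lemma continuous_Im : continuous Im.
Proof.
move=> z; apply/(@cvgrPdist_lt R R _ _ (nbhs_filter z)) => e e0.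
apply: filterS (nbhs_complex z e0) => w /= zw.
rewrite -raddfB/= (le_lt_trans (norm_Im_le _))//.
by rewrite -ltcR RRe_real ?normr_real.
Qed.

Lemma conj_conjc (z : C) : Num.conj z = (Re z) -i* (Im z).
Proof. by case: z. Qed.

Lemma continuous_conj : continuous (Num.conj : C -> C).
Proof.
move=> z; apply/(cvgCP (nbhs_filter z)) => e e0.
apply: filterS (nbhs_complex z e0) => w /= zw.
by rewrite -rmorphB/= norm_conjC.
Qed.

Lemma continuous_norm : continuous (fun z : C => Re `|z|).
Proof.
move=> z; apply/(@cvgrPdist_lt R R _ _ (nbhs_filter z)) => e e0.
apply: filterS (nbhs_complex z e0) => w /= zw.
rewrite -ltcR -norm_real_complex rmorphB /= (le_lt_trans _ zw)//.
exact: (@ler_dist_dist _ C).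
Qed.

Section Limits.
Context {T : Type} {F : set_system T} {FF : Filter F}.
Implicit Types (f g : T -> C) (a b : C).

Lemma cvgC_ext f g a : (\forall x \near F, f x = g x) -> f @ F --> a -> g @ F --> a.
Proof. by move=> fg; apply: cvg_trans; apply: near_eq_cvg. Qed.

Lemma cvgC_cst a : (fun=> a) @ F --> a.
Proof. exact: cvg_cst. Qed.

Lemma cvgC_D f g a b : f @ F --> a -> g @ F --> b -> (fun x => f x + g x) @ F --> a + b.
Proof. exact: (@cvgD C C^o). Qed.

Lemma cvgC_N f a : f @ F --> a -> (fun x => - f x) @ F --> - a.
Proof. exact: (@cvgN C C^o). Qed.

Lemma cvgC_M f g a b : f @ F --> a -> g @ F --> b -> (fun x => f x * g x) @ F --> a * b.
Proof. exact: (@cvgM C). Qed.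

Lemma cvgC_V f a : a != 0 -> f @ F --> a -> (fun x => (f x)^-1) @ F --> a^-1.
Proof. exact: (@cvgV C). Qed.

End Limits.

Lemma real_complex_neq0 (h : R) : h != 0 -> h%:C != 0 :> C.
Proof. by move=> h0; rewrite eq_complex /= negb_and h0. Qed.

(** A closed disc is a closed subset of the image of a square of R^2. *)
Lemma compact_disc (r : R) : compact [set z : C | Re `|z| <= r].
Proof.
pose S : set (R * R) := `[- r, r] `*` `[- r, r].
pose h (p : R * R) : C := p.1%:C + 'i%C * p.2%:C.
have cS : compact S by apply: compact_setX; exact: segment_compact.
have ch : continuous h.
  move=> p; apply: cvgD.
    by apply: (continuous_comp (f := fst)); [exact: cvg_fst|exact: continuous_real_complex].
  apply: cvgM; first exact: cvg_cst.
  by apply: (continuous_comp (f := snd)); [exact: cvg_snd|exact: continuous_real_complex].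
have cD : closed [set z : C | Re `|z| <= r].
  apply: (@closed_comp _ _ (fun z : C => Re `|z|) [set x | x <= r]) => [z _|].
    exact: continuous_norm.
  exact: closed_le.
apply: (subclosed_compact cD (continuous_compact (continuous_subspaceT ch) cS)).
move=> z /= zr; exists (Re z, Im z); last by rewrite /h /= -complexE.
split; rewrite /= in_itv /= -ler_norml.
  exact: le_trans (norm_Re_le z) _.
exact: le_trans (norm_Im_le z) _.
Qed.

End ComplexTopology.

Arguments cvgC_cst {R T F FF} a.
Arguments cvgC_ext {R T F FF f g a}.

(** * Derivatives of complex functions of a real variable *)

Section OneVariable.
Variable R : realType.
Local Notation C := R[i].
Local Notation Re := (@complex.Re R).
Local Notation Im := (@complex.Im R).
Implicit Types (I : set R) (f g : R -> C) (t : R) (d : C).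

(** The value of the derivative as a limit. The increments are restricted as in
    [rderivable], so that the same rules serve one-sided and two-sided
    derivatives. *)
Definition has_rder I f t d : Prop :=
  diffquot f t h @[h --> within [set h | I (t + h)] 0^'] --> d.

Lemma rderivableP I f t : rderivable I f t -> has_rder I f t (rderive I f t).
Proof. by []. Qed.

Lemma has_rder_derivable I f t d : has_rder I f t d -> rderivable I f t.
Proof. by move=> fd; apply/cvg_ex; exists d. Qed.

(** A limit is unique only along a proper filter: this hypothesis says that t is
    not isolated in I. *)
Lemma rderiveE I f t d : ProperFilter (within [set h | I (t + h)] 0^') ->
  has_rder I f t d -> rderive I f t = d.
Proof. by move=> PF; exact: cvg_lim. Qed.

Lemma within_setT_dnbhs (t : R) : within [set h : R | setT (t + h)] 0^' = 0^'.
Proof.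
rewrite /within; apply/seteqP; split=> A /=.
  by apply: filterS => h; exact.
by apply: filterS.
Qed.

Lemma proper_setT t : ProperFilter (within [set h : R | setT (t + h)] 0^').
Proof. by rewrite within_setT_dnbhs; exact: Proper_dnbhs_numFieldType. Qed.

Lemma rderiveTE f t d : has_rder setT f t d -> rderive setT f t = d.
Proof. by apply: rderiveE; exact: proper_setT. Qed.

(** Along the filter of increments one may assume that the increment is nonzero
    and admissible. *)
Lemma near_within I t (P : R -> Prop) :
  (\forall h \near within [set h | I (t + h)] 0^', I (t + h) -> h != 0 -> P h) ->
  \forall h \near within [set h | I (t + h)] 0^', P h.
Proof.
move=> H; near=> h; have Ith : I (t + h) by near: h; exact: withinT.
have h0 : h != 0.
  near: h; have := @nbhs_dnbhs_neq R 0.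
  exact: filterS.
by apply: (near H h).
Unshelve. all: by end_near. Qed.

Lemma has_rder_ext I f g t d :
  (\forall h \near within [set h | I (t + h)] 0^', f (t + h) = g (t + h)) ->
  f t = g t -> has_rder I f t d -> has_rder I g t d.
Proof.
move=> fg fgt; apply: cvgC_ext.
by near=> h; rewrite /diffquot fgt; congr ((_ - _) / _); near: h.
Unshelve. all: by end_near. Qed.

Lemma has_rder_eq I f g t d : f =1 g -> has_rder I f t d -> has_rder I g t d.
Proof. by move=> /funext ->. Qed.

Lemma has_rder_eqd I f t d d' : d = d' -> has_rder I f t d -> has_rder I f t d'.
Proof. by move=> ->. Qed.

Lemma has_rder_nearT f g t d : (\forall s \near t, f s = g s) ->
  has_rder setT f t d -> has_rder setT g t d.
Proof.
move=> fg; apply: has_rder_ext; last exact: nbhs_singleton fg.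
rewrite within_setT_dnbhs; apply: nbhs_dnbhs.
have := fg; rewrite (near_shift (0 : R)) => fg0.
by apply: filterS fg0 => h /=; rewrite subr0 addrC.
Qed.

Lemma has_rder_cvg I f t d : has_rder I f t d ->
  f (t + h) @[h --> within [set h | I (t + h)] 0^'] --> f t.
Proof.
move=> fd; rewrite -[X in _ --> X]addr0 -(mulr0 d) -(rmorph0 (real_complex R)).
have H : f t + diffquot f t h * h%:C @[h --> within [set h | I (t + h)] 0^'] -->
    f t + d * 0%:C.
  apply: cvgC_D; first exact: cvgC_cst.
  apply: cvgC_M; first exact: fd.
  apply: cvg_trans; last exact: (@continuous_real_complex R 0).
  apply: cvg_fmap2; apply: cvg_trans; first exact: cvg_within.
  exact: nbhs_dnbhs.
apply: (cvgC_ext _ H).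
apply: near_within; near=> h => _ h0.
by rewrite /diffquot (mulfVK (real_complex_neq0 h0)) addrC subrK.
Unshelve. all: by end_near. Qed.

Lemma has_rder_cst I c t : has_rder I (fun=> c) t 0.
Proof.
apply: (cvgC_ext _ (cvgC_cst _)).
by near=> h; rewrite /diffquot subrr mul0r.
Unshelve. all: by end_near. Qed.

Lemma has_rder_id I t : has_rder I (fun s => s%:C) t 1.
Proof.
apply: (cvgC_ext _ (cvgC_cst _)).
apply: near_within; near=> h => _ h0.
by rewrite /diffquot -rmorphB /= (addrC t) addrK (divff (real_complex_neq0 h0)).
Unshelve. all: by end_near. Qed.

Lemma has_rderD I f g t d e : has_rder I f t d -> has_rder I g t e ->
  has_rder I (fun s => f s + g s) t (d + e).
Proof.
move=> fd ge; apply: (cvgC_ext _ (cvgC_D fd ge)).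
by near=> h; rewrite /diffquot /=; ring.
Unshelve. all: by end_near. Qed.

Lemma has_rderM I f g t d e : has_rder I f t d -> has_rder I g t e ->
  has_rder I (fun s => f s * g s) t (d * g t + f t * e).
Proof.
move=> fd ge.
apply: (cvgC_ext _ (cvgC_D (cvgC_M fd (has_rder_cvg ge)) (cvgC_M (cvgC_cst (f t)) ge))).
by near=> h; rewrite /diffquot /=; ring.
Unshelve. all: by end_near. Qed.

Lemma has_rderV I f t d : f t != 0 -> has_rder I f t d ->
  has_rder I (fun s => (f s)^-1) t (- (d / (f t * f t))).
Proof.
move=> f0 fd; have cf := has_rder_cvg fd.
apply: (cvgC_ext _ (cvgC_N (cvgC_M fd
  (cvgC_V (mulf_neq0 f0 f0) (cvgC_M cf (cvgC_cst (f t))))))).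
have nf0 : \forall h \near within [set h | I (t + h)] 0^', f (t + h) != 0.
  have f1 : 0 < Normc.normc (f t).
    by rewrite -ltcR; rewrite -[X in _ < X]/(`|f t|) normr_gt0.
  apply: filterS ((cvgCP _ _ _).1 cf _ f1) => h /=.
  by apply: contraTneq => ->; rewrite subr0 ltxx.
near=> h; have h0 : f (t + h) != 0 by near: h.
rewrite /diffquot /=.
rewrite [in LHS](_ : (f (t + h) * f t)^-1 = (f (t + h))^-1 / f t) ?invfM//.
move: (h%:C^-1) => k; field.
by rewrite h0 f0.
Unshelve. all: by end_near. Qed.

Lemma has_rder_conj I f t d : has_rder I f t d ->
  has_rder I (fun s => Num.conj (f s)) t (Num.conj d).
Proof.
move=> fd.
have H := @cvg_comp _ _ _ (diffquot f t) Num.conj _ _ _ fd (@continuous_conj R d).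
apply: (cvgC_ext _ H).
near=> h; rewrite /diffquot /= rmorphM rmorphB /= fmorphV; congr (_ / _).
by rewrite [LHS]conj_Creal// complex_real.
Unshelve. all: by end_near. Qed.

Lemma has_rder_real (u : R -> R) t (d : R) :
  is_derive t 1 u d -> has_rder setT (fun s => (u s)%:C) t d%:C.
Proof.
move=> [du ud]; rewrite /has_rder within_setT_dnbhs.
have := @continuous_real_complex R d.
have : h^-1 *: (u (h *: 1 + t) - u t) @[h --> 0^'] --> d by rewrite -ud.
move=> /cvg_comp /[apply] H; apply: (cvgC_ext _ H).
near=> h; rewrite /diffquot /= /GRing.scale/= mulr1 (addrC h) mulrC rmorphM rmorphB /=.
by rewrite fmorphV.
Unshelve. all: by end_near. Qed.

Lemma is_derive_Re f t d :
  has_rder setT f t d -> is_derive t 1 (fun s => Re (f s)) (Re d).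
Proof.
rewrite /has_rder within_setT_dnbhs => fd.
have H : h^-1 *: (Re (f (h *: 1 + t)) - Re (f t)) @[h --> 0^'] --> Re d.
  apply: cvg_trans (@cvg_comp _ _ _ (diffquot f t) Re _ _ _ fd (@continuous_Re R d)).
  apply: near_eq_cvg.
  near=> h; rewrite /diffquot /= /GRing.scale/= mulr1 (addrC h) -raddfB.
  by rewrite -fmorphV mulrC; case: (f _ - f _) => a b /=; simpc.
apply: DeriveDef; first by apply/cvg_ex; exists (Re d).
exact: cvg_lim H.
Unshelve. all: by end_near. Qed.

Lemma is_derive_Im f t d :
  has_rder setT f t d -> is_derive t 1 (fun s => Im (f s)) (Im d).
Proof.
move=> fd.
have := is_derive_Re (has_rderM fd (has_rder_cst setT (- 'i%C) t)).
rewrite mulr0 addr0 mulrN raddfN /= ReiNIm opprK.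
congr is_derive.
by apply/funext => s; rewrite mulrN raddfN /= ReiNIm opprK.
Qed.

(** The logarithm is real, so this goes through the chain rule for real functions. *)
Lemma has_rder_ln f t d : 0 < f t -> has_rder setT f t d ->
  has_rder setT (fun s => (ln (Re (f s)))%:C) t (Re d / Re (f t))%:C.
Proof.
move=> /gt0_complex_real[_ f0] /is_derive_Re fd; apply: has_rder_real.
rewrite [_ / _]mulrC.
have H := is_derive1_comp (is_derive1_ln f0) fd.
exact H.
Qed.

End OneVariable.

(** * Functions of class C^k on an open subset of C^n *)

Section Directional.
Variables (R : realType) (n : nat).
Local Notation C := R[i].
Local Notation Cn := 'rV[R[i]]_n.
Local Notation Re := (@complex.Re R).
Local Notation Im := (@complex.Im R).
Implicit Types (f g : Cn -> C) (z v : Cn) (d : C).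

Definition has_dirder v f z d := has_rder setT (fun s => f (z + s%:C *: v)) 0 d.

Lemma dirderE v f z d : has_dirder v f z d -> dirder v f z = d.
Proof. exact: rderiveTE. Qed.

Lemma line0 z v : z + (0 : R)%:C *: v = z.
Proof. by rewrite rmorph0 scale0r addr0. Qed.

Lemma continuous_line z v : continuous (fun s : R => z + s%:C *: v).
Proof.
move=> s; apply: cvgD; first exact: cvg_cst.
apply: cvgZr_tmp; exact: continuous_real_complex.
Qed.

Lemma near_line z v (P : Cn -> Prop) :
  (\forall w \near z, P w) -> \forall s \near (0 : R), P (z + s%:C *: v).
Proof. by move=> Pz; apply: (@continuous_line z v 0); rewrite line0. Qed.

Lemma has_dirder_near v f g z d : (\forall w \near z, f w = g w) ->
  has_dirder v f z d -> has_dirder v g z d.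
Proof. by move=> fg; apply: has_rder_nearT; exact: (@near_line z v (fun w => f w = g w)). Qed.

Lemma has_dirder_cst v (c : C) z : has_dirder v (fun=> c) z 0.
Proof. exact: has_rder_cst. Qed.

Lemma has_dirderD v f g z d e : has_dirder v f z d -> has_dirder v g z e ->
  has_dirder v (fun w => f w + g w) z (d + e).
Proof. exact: has_rderD. Qed.

Lemma has_dirderM v f g z d e : has_dirder v f z d -> has_dirder v g z e ->
  has_dirder v (fun w => f w * g w) z (d * g z + f z * e).
Proof. by move=> fd ge; have := has_rderM fd ge; rewrite line0. Qed.

Lemma has_dirderV v f z d : f z != 0 -> has_dirder v f z d ->
  has_dirder v (fun w => (f w)^-1) z (- (d / (f z * f z))).
Proof.
move=> f0 fd; have f0' : f (z + (0 : R)%:C *: v) != 0 by rewrite line0.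
by have := has_rderV f0' fd; rewrite line0.
Qed.

Lemma has_dirder_conj v f z d : has_dirder v f z d ->
  has_dirder v (fun w => Num.conj (f w)) z (Num.conj d).
Proof. exact: has_rder_conj. Qed.

Lemma has_dirder_ln v f z d : 0 < f z -> has_dirder v f z d ->
  has_dirder v (fun w => (ln (Re (f w)))%:C) z (Re d / Re (f z))%:C.
Proof.
move=> f0 fd; have f0' : 0 < f (z + (0 : R)%:C *: v) by rewrite line0.
by have := has_rder_ln f0' fd; rewrite line0.
Qed.

Lemma has_dirder_coord v z (i : 'I_n) : has_dirder v (fun w => w 0 i) z (v 0 i).
Proof.
have := has_rderD (has_rder_cst setT (z 0 i) 0)
  (has_rderM (has_rder_id setT 0) (has_rder_cst setT (v 0 i) 0)).
rewrite mulr0 mul1r addr0 add0r; apply: has_rder_eq => s.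
by rewrite !mxE.
Qed.

Variable U : set Cn.
Hypothesis oU : open U.

Lemma near_open z (P : Cn -> Prop) : (forall w, U w -> P w) -> U z ->
  \forall w \near z, P w.
Proof.
by move=> UP Uz; apply: filterS UP _; apply: open_nbhs_nbhs.
Qed.

(** Class C^k on U, by recursion on k. Unlike the definition by words of
    directions, it exposes the innermost derivative, which is what closure
    proofs by induction need. *)
Fixpoint Ck k f : Prop :=
  (forall z, U z -> f @ z --> f z) /\
  if k is k'.+1 then
    (forall v z, U z -> rderivable setT (fun s => f (z + s%:C *: v)) 0) /\
    (forall v, Ck k' (dirder v f))
  else True.

Lemma Ck_cont k f z : Ck k f -> U z -> f @ z --> f z.
Proof. by case: k => [|k] [+ _]; exact. Qed.

Lemma Ck_dirder k f v z : Ck k.+1 f -> U z -> has_dirder v f z (dirder v f z).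
Proof. by move=> [_ [fd _]] Uz; exact: fd. Qed.

Lemma Ck_dirder_Ck k f v : Ck k.+1 f -> Ck k (dirder v f).
Proof. by move=> [_ [_ +]]; exact. Qed.

Lemma Ck0 f : (forall z, U z -> f @ z --> f z) -> Ck 0 f.
Proof. by move=> cf; split; first exact: cf. Qed.

Lemma Ck_succ k f : (forall z, U z -> f @ z --> f z) ->
  (forall v z, U z -> exists d, has_dirder v f z d) ->
  (forall v, Ck k (dirder v f)) -> Ck k.+1 f.
Proof.
move=> cf df Cf; split; first exact: cf.
split; last exact: Cf.
by move=> v z Uz; have [d fd] := df v z Uz; exact: has_rder_derivable fd.
Qed.

Lemma Ck_eq k f g : (forall z, U z -> f z = g z) -> Ck k f -> Ck k g.
Proof.
elim: k f g => [|k IH] f g fg.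
  move=> [cf _]; apply: Ck0 => z Uz; rewrite -(fg z Uz).
  by apply: (cvgC_ext _ (cf z Uz)); exact: (@near_open z (fun w => f w = g w)).
move=> Cf; apply: Ck_succ.
- move=> z Uz; rewrite -(fg z Uz).
  by apply: (cvgC_ext _ (Ck_cont Cf Uz)); exact: (@near_open z (fun w => f w = g w)).
- move=> v z Uz; exists (dirder v f z).
  by apply: (has_dirder_near _ (Ck_dirder Cf Uz)); exact: (@near_open z (fun w => f w = g w)).
- move=> v; apply: IH (Ck_dirder_Ck v Cf) => z Uz; apply/esym/dirderE.
  by apply: (has_dirder_near _ (Ck_dirder Cf Uz)); exact: (@near_open z (fun w => f w = g w)).
Qed.

(** Closure under an operation reduces to a formula for the derivative in terms of
    functions already known to be of class C^k. *)
Lemma Ck_of_derivative k f (df : Cn -> Cn -> C) : (forall z, U z -> f @ z --> f z) ->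
  (forall v z, U z -> has_dirder v f z (df v z)) ->
  (forall v, Ck k (df v)) -> Ck k.+1 f.
Proof.
move=> cf fd Cd; apply: (Ck_succ cf); first by move=> v z Uz; exists (df v z); exact: fd.
by move=> v; apply: Ck_eq (Cd v) => z Uz; rewrite (dirderE (fd v z Uz)).
Qed.

Lemma Ck_pred k f : Ck k.+1 f -> Ck k f.
Proof.
elim: k f => [|k IH] f Cf; first by apply: Ck0 => z Uz; exact: Ck_cont Cf Uz.
apply: (@Ck_of_derivative _ _ (fun v => dirder v f)).
- by move=> z; exact: Ck_cont Cf.
- by move=> v z; exact: Ck_dirder Cf.
- by move=> v; apply: IH; exact: Ck_dirder_Ck Cf.
Qed.

Lemma Ck_cst k (c : C) : Ck k (fun=> c).
Proof.
elim: k c => [|k IH] c; first by apply: Ck0 => z _; exact: (@cvgC_cst R _ (nbhs z)).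
apply: (@Ck_of_derivative _ _ (fun _ _ => 0)).
- by move=> z _; exact: (@cvgC_cst R _ (nbhs z)).
- by move=> v z _; exact: has_dirder_cst.
- by move=> v; exact: IH.
Qed.

Lemma Ck_coord k (i : 'I_n) : Ck k (fun z => z 0 i).
Proof.
have cc z : (fun w : Cn => w 0 i) @ z --> z 0 i by exact: coord_continuous.
case: k => [|k]; first by apply: Ck0 => z _; exact: cc.
apply: (@Ck_of_derivative _ _ (fun v _ => v 0 i)).
- by move=> z _; exact: cc.
- by move=> v z _; exact: has_dirder_coord.
- by move=> v; exact: Ck_cst.
Qed.

Lemma CkD k f g : Ck k f -> Ck k g -> Ck k (fun z => f z + g z).
Proof.
have cc k' f' g' : Ck k' f' -> Ck k' g' ->
    forall z, U z -> (fun z => f' z + g' z) @ z --> f' z + g' z.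
  by move=> Cf Cg z Uz; exact: (cvgC_D (Ck_cont Cf Uz) (Ck_cont Cg Uz)).
elim: k f g => [|k IH] f g Cf Cg; first by apply: Ck0; exact: cc Cf Cg.
apply: (@Ck_of_derivative _ _ (fun v z => dirder v f z + dirder v g z)); first exact: cc Cf Cg.
  by move=> v z Uz; exact: (has_dirderD (Ck_dirder Cf Uz) (Ck_dirder Cg Uz)).
by move=> v; apply: IH; exact: Ck_dirder_Ck.
Qed.

Lemma CkM k f g : Ck k f -> Ck k g -> Ck k (fun z => f z * g z).
Proof.
have cc k' f' g' : Ck k' f' -> Ck k' g' ->
    forall z, U z -> (fun z => f' z * g' z) @ z --> f' z * g' z.
  by move=> Cf Cg z Uz; exact: (cvgC_M (Ck_cont Cf Uz) (Ck_cont Cg Uz)).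
elim: k f g => [|k IH] f g Cf Cg; first by apply: Ck0; exact: cc Cf Cg.
apply: (@Ck_of_derivative _ _ (fun v z => dirder v f z * g z + f z * dirder v g z)).
- exact: cc Cf Cg.
- by move=> v z Uz; exact: (has_dirderM (Ck_dirder Cf Uz) (Ck_dirder Cg Uz)).
- by move=> v; apply: CkD; apply: IH => //; by [exact: Ck_dirder_Ck|exact: Ck_pred].
Qed.

Lemma CkN k f : Ck k f -> Ck k (fun z => - f z).
Proof.
move=> Cf; apply: Ck_eq (CkM (Ck_cst k (-1)) Cf) => z _.
by rewrite mulN1r.
Qed.

Lemma CkV k f : (forall z, U z -> f z != 0) -> Ck k f -> Ck k (fun z => (f z)^-1).
Proof.
move=> f0.
have cc k' : Ck k' f -> forall z, U z -> (fun z => (f z)^-1) @ z --> (f z)^-1.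
  by move=> Cf z Uz; exact: (cvgC_V (f0 z Uz) (Ck_cont Cf Uz)).
elim: k => [|k IH] Cf; first by apply: Ck0; exact: cc Cf.
apply: (@Ck_of_derivative _ _ (fun v z => - (dirder v f z / (f z * f z)))).
- exact: cc Cf.
- by move=> v z Uz; exact: (has_dirderV (f0 z Uz) (Ck_dirder Cf Uz)).
- have CV := IH (Ck_pred Cf).
  move=> v; apply: CkN; apply: CkM; first exact: Ck_dirder_Ck.
  by apply: Ck_eq (CkM CV CV) => z _; rewrite invfM.
Qed.

Lemma Ck_conj k f : Ck k f -> Ck k (fun z => Num.conj (f z)).
Proof.
have cc k' f' : Ck k' f' ->
    forall z, U z -> (fun z => Num.conj (f' z)) @ z --> Num.conj (f' z).
  move=> Cf z Uz; apply: (@cvg_comp _ _ _ f' Num.conj); first exact: Ck_cont Cf Uz.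
  exact: continuous_conj.
elim: k f => [|k IH] f Cf; first by apply: Ck0; exact: cc Cf.
apply: (@Ck_of_derivative _ _ (fun v z => Num.conj (dirder v f z))).
- exact: cc Cf.
- by move=> v z Uz; exact: (has_dirder_conj (Ck_dirder Cf Uz)).
- by move=> v; apply: IH; exact: Ck_dirder_Ck.
Qed.

(** The derivative is Re (df) / f, and Re (df) is half of df plus its conjugate. *)
Lemma Ck_ln k f : (forall z, U z -> 0 < f z) -> Ck k f ->
  Ck k (fun z => (ln (Re (f z)))%:C).
Proof.
move=> f0.
have cc k' : Ck k' f -> forall z, U z ->
    (fun z => (ln (Re (f z)))%:C) @ z --> (ln (Re (f z)))%:C.
  move=> Cf z Uz.
  apply: (@cvg_comp _ _ _ f (fun y : C => (ln (Re y))%:C) _ (nbhs (f z))).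
    exact: Ck_cont Cf Uz.
  apply: (@cvg_comp _ _ _ Re (fun y : R => (ln y)%:C) _ (nbhs (Re (f z)))).
    exact: continuous_Re.
  apply: (@cvg_comp _ _ _ (@ln R) (fun y : R => y%:C) _ (nbhs (ln (Re (f z))))).
    by apply: continuous_ln; have [_] := gt0_complex_real (f0 z Uz).
  exact: continuous_real_complex.
case: k => [|k] Cf; first by apply: Ck0; exact: cc Cf.
apply: (@Ck_of_derivative _ _ (fun v z => (Re (dirder v f z) / Re (f z))%:C)).
- exact: cc Cf.
- by move=> v z Uz; exact: (has_dirder_ln (f0 z Uz) (Ck_dirder Cf Uz)).
- move=> v.
  have CV : Ck k (fun z => (f z)^-1).
    by apply: CkV; [move=> z /f0; exact: lt0r_neq0|exact: Ck_pred].
  have Cd := Ck_dirder_Ck v Cf.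
  apply: Ck_eq (CkM (CkM (CkD Cd (Ck_conj Cd)) (Ck_cst k 2^-1)) CV) => z Uz.
  have [fE _] := gt0_complex_real (f0 z Uz).
  by rewrite rmorphM /= fmorphV /= -fE ReJ_add.
Qed.

Lemma Ck_sum k (J : Type) (r : seq J) (P : pred J) (F : J -> Cn -> C) :
  (forall j, P j -> Ck k (F j)) -> Ck k (fun z => \sum_(j <- r | P j) F j z).
Proof.
move=> CF; elim: r => [|j r IH].
  by apply: Ck_eq (Ck_cst k 0) => z _; rewrite big_nil.
case Pj: (P j); last by apply: Ck_eq IH => z _; rewrite big_cons Pj.
by apply: Ck_eq (CkD (CF j Pj) IH) => z _; rewrite big_cons Pj.
Qed.

Lemma Ck_prod k (J : Type) (r : seq J) (P : pred J) (F : J -> Cn -> C) :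
  (forall j, P j -> Ck k (F j)) -> Ck k (fun z => \prod_(j <- r | P j) F j z).
Proof.
move=> CF; elim: r => [|j r IH].
  by apply: Ck_eq (Ck_cst k 1) => z _; rewrite big_nil.
case Pj: (P j); last by apply: Ck_eq IH => z _; rewrite big_cons Pj.
by apply: Ck_eq (CkM (CF j Pj) IH) => z _; rewrite big_cons Pj.
Qed.

Lemma Ck_det k m (A : Cn -> 'M[C]_m) :
  (forall i j, Ck k (fun z => A z i j)) -> Ck k (fun z => \det (A z)).
Proof.
move=> CA; rewrite /determinant; apply: Ck_sum => s _.
by apply: CkM; [exact: Ck_cst|apply: Ck_prod => i _; exact: CA].
Qed.

Lemma smooth_onP f : smooth_on U f <-> forall k, Ck k f.
Proof.
split=> [sf k|Cf vs].
  suff H vs : Ck k (iter_dirder vs f) by exact: (H [::]).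
  elim: k vs => [|k IH] vs; have [cf df] := sf vs.
    apply: Ck0 => z Uz.
    by move: cf; rewrite continuous_open_subspace// => /(_ z (mem_set Uz)).
  split; first by move=> z Uz;
    move: cf; rewrite continuous_open_subspace// => /(_ z (mem_set Uz)).
  by split=> [|v]; [exact: df|exact: (IH (v :: vs))].
have H k : Ck k (iter_dirder vs f).
  by elim: vs k => [|v vs IH] k //=; exact: Ck_dirder_Ck.
split; last by move=> v z Uz; have [_ [+ _]] := H 1%N; exact.
rewrite continuous_open_subspace// => z /set_mem Uz.
exact: (Ck_cont (H 0%N)).
Qed.

End Directional.

(** * The mean value inequality and the second derivative test *)

Section MeanValue.
Variable R : realType.
Local Notation C := R[i].
Local Notation Re := (@complex.Re R).
Local Notation Im := (@complex.Im R).

Lemma norm_le_ReIm (z : C) (a b : R) : `|Re z| <= a -> `|Im z| <= b ->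
  `|z| <= (a + b)%:C.
Proof.
move=> za zb; rewrite [z]complexE (le_trans (ler_normD _ _))// normrM.
by rewrite norm_i mul1r !norm_real_complex -rmorphD lecR lerD.
Qed.

Lemma mean_value_real (g g' : R -> R) (a b L e : R) : a <= b ->
  (forall x, x \in `]a, b[ -> is_derive x 1 g (g' x)) ->
  {within `[a, b], continuous g} ->
  (forall x, x \in `]a, b[ -> `|g' x - L| <= e) ->
  `|g b - g a - (b - a) * L| <= e * (b - a).
Proof.
rewrite le_eqVlt => /predU1P[-> _ _ _|ab dg cg gL].
  by rewrite !subrr mul0r mulr0 subr0 normr0.
have [c cab ->] := MVT ab dg cg.
have ba : 0 <= b - a by rewrite subr_ge0 ltW.
by rewrite (mulrC (b - a)) -mulrBl normrM [X in _ * X](ger0_norm ba) ler_wpM2r ?gL.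
Qed.

(** The factor 2 is the price of applying the real mean value theorem to the real
    and imaginary parts separately. *)
Lemma mean_value (g g' : R -> C) (a b : R) (L : C) (e : R) : a <= b ->
  (forall x, x \in `]a, b[ -> has_rder setT g x (g' x)) ->
  {within `[a, b], continuous g} ->
  (forall x, x \in `]a, b[ -> `|g' x - L| <= e%:C) ->
  `|g b - g a - (b - a)%:C * L| <= (2 * e * (b - a))%:C.
Proof.
move=> ab dg cg gL.
have le_of (x y : C) : `|x - y| <= e%:C -> Re `|x - y| <= e.
  by rewrite -[X in X <= _]RRe_real ?normr_real// lecR.
rewrite (_ : 2 * e * (b - a) = e * (b - a) + e * (b - a)); last by ring.
apply: norm_le_ReIm.
- rewrite !(ReD, ReN) Re_rM.
  apply: (@mean_value_real (fun t => Re (g t)) (fun t => Re (g' t))) => //.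
  + by move=> x /dg; exact: is_derive_Re.
  + move=> x; apply: (@cvg_comp _ _ _ g Re); first exact: (cg x).
    exact: continuous_Re.
  + move=> x /gL/le_of; apply: le_trans.
    by rewrite -ReN -ReD; exact: norm_Re_le.
- rewrite !(ImD, ImN) Im_rM.
  apply: (@mean_value_real (fun t => Im (g t)) (fun t => Im (g' t))) => //.
  + by move=> x /dg; exact: is_derive_Im.
  + move=> x; apply: (@cvg_comp _ _ _ g Im); first exact: (cg x).
    exact: continuous_Im.
  + move=> x /gL/le_of; apply: le_trans.
    by rewrite -ImN -ImD; exact: norm_Im_le.
Qed.

Lemma has_rder_continuous (g : R -> C) t d : has_rder setT g t d ->
  g @ t --> g t.
Proof.
move=> /has_rder_cvg; rewrite within_setT_dnbhs => gt.
apply/cvgCP => e e0; have := (cvgCP _ _ _).1 gt _ e0.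
move=> H.
have {}H : \forall h \near (0 : R), h != 0 -> `|g t - g (t + h)| < e%:C by exact: H.
rewrite (near_shift t) in H.
apply: filterS H => s /=; rewrite sub0r [t + _]addrC subrK => H.
have [->|st] := eqVneq s t; first by rewrite subrr normr0 ltcR.
by apply: H; rewrite subr_eq0.
Qed.

(** If c > 0 then g' is positive just after 0, where g' vanishes, so g exceeds
    its maximum. *)
Lemma second_derivative_le0 (g g' : R -> R) (c : R) :
  (\forall s \near (0 : R), is_derive (s : R) (1 : R) g (g' s)) ->
  is_derive (0 : R) (1 : R) g' c ->
  (\forall s \near (0 : R), g s <= g 0) -> c <= 0.
Proof.
move=> dg [cvg' g'c] gmax; rewrite leNgt; apply/negP => c0.
have [d /= d0 dP] : exists2 d : R, 0 < d & forall s, `|s| < d ->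
    is_derive (s : R) (1 : R) g (g' s) /\ g s <= g 0.
  have /nbhs_ballP[d /= d0 dP] : \forall s \near (0 : R),
      is_derive (s : R) (1 : R) g (g' s) /\ g s <= g 0 by apply: filterI.
  by exists d => // s sd; apply: dP; rewrite /ball/= sub0r normrN.
have in_d s : s \in `]-d, d[ -> `|s| < d by rewrite in_itv /= ltr_norml.
have d00 : `|0 : R| < d by rewrite normr0.
have g'0 : g' 0 = 0.
  have : is_derive (0 : R) (1 : R) g 0.
    apply: (@derive1_at_max _ g (-d) d 0).
    - by rewrite (@le_trans _ _ 0)// ?oppr_le0 ltW.
    - by move=> t /in_d/dP[].
    - by rewrite in_itv/= oppr_lt0 d0.
    - by move=> t /in_d/dP[].
  have [[_ <-] _] := dP 0 d00.
  by case.
have : h^-1 *: (g' (h *: 1 + 0) - g' 0) @[h --> 0^'] --> c by rewrite -g'c.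
move=> /cvgrPdist_lt/(_ _ c0) H.
have /nbhs_ballP[d2 /= d20 d2P] : \forall h \near (0 : R), h != 0 -> 0 < h^-1 * g' h.
  have {}H : \forall h \near (0 : R), h != 0 ->
    `|c - h^-1 *: (g' (h *: 1 + 0) - g' 0)| < c by exact: H.
  apply: filterS H => h /= /[apply].
  rewrite g'0 subr0 addr0 /GRing.scale /= mulr1 ltr_distlC => /andP[+ _].
  by rewrite subrr.
pose s := Num.min d d2 / 2.
have s0 : 0 < s by rewrite divr_gt0// lt_min d0.
have [sd sd2] : s < d /\ s < d2.
  have : s < Num.min d d2 by rewrite /s ltr_pdivrMr// ltr_pMr ?ltr1n// lt_min d0.
  by rewrite lt_min => /andP[].
have small x : x \in `[0, s] -> `|x| < d.
  by rewrite in_itv/= => /andP[x0 xs]; rewrite ger0_norm// (le_lt_trans xs).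
have [x|x|x] := @MVT _ g g' 0 s s0.
- by move=> /subset_itv_oo_cc/small/dP[].
- apply: derivable_within_continuous => y /small/dP[] [] + _ _; exact.
- rewrite in_itv /= subr0 => /andP[x0 xs] gE.
  have : 0 < g' x.
    have := d2P x; rewrite /ball/= sub0r normrN gtr0_norm// => /(_ (lt_trans xs sd2)).
    by rewrite gt_eqF// => /(_ isT); rewrite pmulr_rgt0// invr_gt0.
  have [_ gs] := dP s (eq_ind_r (fun y => y < d) sd (gtr0_norm s0)).
  move=> g'x; have : 0 < g s - g 0 by rewrite gE mulr_gt0.
  by rewrite subr_gt0 ltNge gs.
Qed.

End MeanValue.

(** * Linearity in the direction and the Levi form *)

Section LinearDirection.
Variables (R : realType) (n : nat).
Local Notation C := R[i].
Local Notation Cn := 'rV[R[i]]_n.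
Local Notation Re := (@complex.Re R).
Local Notation Im := (@complex.Im R).
Implicit Types (f g : Cn -> C) (z v w : Cn).

Lemma has_rder_shift (g : R -> C) (s : R) (d : C) :
  has_rder setT (fun h => g (s + h)) 0 d -> has_rder setT g s d.
Proof.
rewrite /has_rder !within_setT_dnbhs => gd.
apply: (cvgC_ext _ gd); near=> h.
by rewrite /diffquot add0r addr0.
Unshelve. all: by end_near. Qed.

Lemma has_rder_line v f z (s : R) d : has_dirder v f (z + s%:C *: v) d ->
  has_rder setT (fun h => f (z + h%:C *: v)) s d.
Proof.
move=> fd; apply: has_rder_shift; apply: has_rder_eq fd => h /=.
by rewrite rmorphD scalerDl addrA.
Qed.

Lemma has_dirder_scale (a : R) v f z d : has_dirder v f z d ->
  has_dirder (a%:C *: v) f z (a%:C * d).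
Proof.
move=> fd; have [->|a0] := eqVneq a 0.
  rewrite mul0r; apply: has_rder_eq (has_rder_cst setT (f z) 0) => s.
  by rewrite scale0r scaler0 addr0.
have aC := real_complex_neq0 a0.
rewrite /has_dirder /has_rder within_setT_dnbhs.
have fd' : diffquot (fun s => f (z + s%:C *: v)) 0 h @[h --> 0^'] --> d.
  by move: fd; rewrite /has_dirder /has_rder within_setT_dnbhs.
have ca : (fun h : R => a * h) @ 0^' --> 0^'.
  move=> A A0; have {}A0 : \forall y \near (0 : R), y != 0 -> A y by exact: A0.
  have : \forall h \near (0 : R), a * h != 0 -> A (a * h).
    have ca0 := @mulrl_continuous R a 0; rewrite /continuous_at mulr0 in ca0.
    exact: (ca0 _ A0).
  by apply: filterS => h Ah h0; apply: Ah; rewrite mulf_neq0.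
apply: (cvgC_ext _ (cvgC_M (cvgC_cst a%:C) (@cvg_comp _ _ _ _ _ _ _ _ ca fd'))).
near=> h; rewrite /diffquot /= !add0r rmorphM /=.
rewrite invfM mulrCA mulrA mulrA (mulrC a%:C) mulfK// !scalerA.
by rewrite !rmorph0 mul0r.
Unshelve. all: by end_near. Qed.

Lemma has_dirderZ (c : C) v f z d : has_dirder v f z d ->
  has_dirder v (fun w => c * f w) z (c * d).
Proof.
move=> fd; have H := has_dirderM (has_dirder_cst v c z) fd.
by refine (has_rder_eqd _ H); rewrite mul0r add0r.
Qed.

Variable U : set Cn.
Hypothesis oU : open U.

(** The increment along v + w is split into a step along v and a step along w
    from the displaced point; the mean value inequality and continuity of the
    derivative along w control the second step. *)
Lemma has_dirder_add f v w z : Ck U 1 f -> U z ->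
  has_dirder (v + w) f z (dirder v f z + dirder w f z).
Proof.
move=> Cf Uz.
have fv := Ck_dirder (v := v) Cf Uz.
have quot_w : (f (z + h%:C *: v + h%:C *: w) - f (z + h%:C *: v)) / h%:C
    @[h --> (0 : R)^'] --> dirder w f z.
  apply/cvgCP => e e0.
  (* 2 * (e / 4) < e, with 2 the factor in the mean value inequality *)
  pose P y := U y /\ `|dirder w f z - dirder w f y| < (e / 4)%:C.
  have Pz : \forall y \near z, P y.
    apply: filterI; first exact: open_nbhs_nbhs.
    have := Ck_cont (Ck_dirder_Ck w Cf) Uz.
    by move/cvgCP; apply; rewrite divr_gt0.
  have [d /= d0 dP] : exists2 d : R, 0 < d & forall s t : R, `|s| < d -> `|t| < d ->
      P (z + s%:C *: v + t%:C *: w).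
    have cst2 : (fun p : R * R => z + p.1%:C *: v + p.2%:C *: w) @ (0 : R, 0 : R) --> z.
      rewrite -[X in _ --> X](line0 z v) -[X in _ --> X](line0 _ w).
      apply: cvgD; first apply: cvgD; first exact: cvg_cst.
        apply: cvgZr_tmp; apply: (@cvg_comp _ _ _ fst (fun x : R => x%:C)).
          exact: cvg_fst.
        exact: continuous_real_complex.
      apply: cvgZr_tmp; apply: (@cvg_comp _ _ _ snd (fun x : R => x%:C)).
        exact: cvg_snd.
      exact: continuous_real_complex.
    have /nbhs_ballP[d /= d0 dP] := cst2 _ Pz.
    exists d => // s t sd td; apply: (dP (s, t)).
    by split; rewrite /ball/= sub0r normrN.
  near=> h.
  have hd : `|h| < d by near: h; exact: dnbhs0_lt.
  have h0 : h != 0 by near: h; exact: nbhs_dnbhs_neq.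
  pose g t := f (z + h%:C *: v + t%:C *: w).
  pose g' t := dirder w f (z + h%:C *: v + t%:C *: w).
  have gg' t : `|t| < d -> has_rder setT g t (g' t).
    by move=> td; apply: has_rder_line; have [Ut _] := dP h t hd td; exact: Ck_dirder Cf Ut.
  have mvt (a b : R) : a <= b -> (forall t, t \in `[a, b] -> `|t| < d) ->
      `|g b - g a - (b - a)%:C * dirder w f z| <= (2 * (e / 4) * (b - a))%:C.
    move=> ab abd; apply: (@mean_value _ g g').
    - exact: ab.
    - by move=> x /subset_itv_oo_cc/abd; exact: gg'.
    - apply: continuous_in_subspaceT => x; rewrite inE => /abd/gg'.
      exact: has_rder_continuous.
    - move=> x /subset_itv_oo_cc/abd xd; have [_ +] := dP h x hd xd.
      by rewrite distrC; exact: ltW.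
  have key : `|g h - g 0 - h%:C * dirder w f z| <= (2 * (e / 4) * `|h|)%:C.
    have [hp|hn] := leP 0 h.
      have /(mvt 0 h hp) : forall t, t \in `[0, h] -> `|t| < d.
        move=> t; rewrite in_itv/= => /andP[t0 th].
        by rewrite ger0_norm// (le_lt_trans th)// -(ger0_norm hp).
      by rewrite subr0 (ger0_norm hp).
    have /(mvt h 0 (ltW hn)) : forall t, t \in `[h, 0] -> `|t| < d.
      move=> t; rewrite in_itv/= => /andP[th t0].
      by rewrite ler0_norm// (le_lt_trans _ hd)// (ltr0_norm hn) lerN2.
    rewrite sub0r (ltr0_norm hn) -[X in X <= _]normrN; congr (`|_| <= _).
    by rewrite rmorphN /=; ring.
  have hC := real_complex_neq0 h0.
  rewrite distrC -[X in _ - X](mulfK hC) (mulrC (dirder w f z)) -mulrBl.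
  rewrite [X in X * _](_ : _ = g h - g 0 - h%:C * dirder w f z); last first.
    by rewrite /g line0.
  rewrite normrM normfV norm_real_complex ltr_pdivrMr; last first.
    by rewrite ltcR normr_gt0.
  rewrite (le_lt_trans key)// -rmorphM /= ltcR ltr_pM2r ?normr_gt0//.
  by rewrite mulrCA mulrA ltr_pdivrMr// ltr_pM2l// ltr_nat.
rewrite /has_dirder /has_rder within_setT_dnbhs [dirder v f z + _]addrC.
have fv' : diffquot (fun s => f (z + s%:C *: v)) 0 h @[h --> 0^'] --> dirder v f z.
  by move: fv; rewrite /has_dirder /has_rder within_setT_dnbhs.
apply: (cvgC_ext _ (cvgC_D quot_w fv')); near=> h.
rewrite /diffquot !add0r !line0 scalerDr -mulrDl addrA; congr (_ / _).
by rewrite subrK (addrA z).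
Unshelve. all: by end_near. Qed.

Lemma dirder_add f v w z : Ck U 1 f -> U z ->
  dirder (v + w) f z = dirder v f z + dirder w f z.
Proof. by move=> Cf Uz; apply: dirderE; exact: has_dirder_add. Qed.

Lemma dirder_scale f (a : R) v z : Ck U 1 f -> U z ->
  dirder (a%:C *: v) f z = a%:C * dirder v f z.
Proof. by move=> Cf Uz; apply/dirderE/has_dirder_scale; exact: Ck_dirder Cf Uz. Qed.

Lemma dirder_sum (J : Type) (r : seq J) (v : J -> Cn) f z : Ck U 1 f -> U z ->
  dirder (\sum_(j <- r) v j) f z = \sum_(j <- r) dirder (v j) f z.
Proof.
move=> Cf Uz; elim: r => [|j r IH]; last by rewrite !big_cons (dirder_add _ _ Cf Uz) IH.
have := dirder_scale 0 0 Cf Uz.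
by rewrite rmorph0 scale0r mul0r !big_nil.
Qed.

Lemma dirderEbase f v z : Ck U 1 f -> U z ->
  dirder v f z = \sum_i ((Re (v 0 i))%:C * dirder (ebase R i) f z +
                         (Im (v 0 i))%:C * dirder ('i%C *: ebase R i) f z).
Proof.
move=> Cf Uz; rewrite [in LHS](row_sum_delta v) (dirder_sum _ _ Cf Uz).
apply: eq_bigr => i _; rewrite -!(dirder_scale _ _ Cf Uz) -(dirder_add _ _ Cf Uz).
by rewrite scalerA -scalerDl (mulrC _ 'i%C) -complexE.
Qed.

Lemma sqr_iC : 'i%C * 'i%C = -1 :> C.
Proof. by rewrite -expr2 sqr_i. Qed.

(** The (1,0) part of the derivative along v. *)
Lemma sum_dz f v z : Ck U 1 f -> U z ->
  \sum_i v 0 i * dz i f z = (dirder v f z - 'i%C * dirder ('i%C *: v) f z) / 2.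
Proof.
move=> Cf Uz; rewrite (dirderEbase v Cf Uz) (dirderEbase ('i%C *: v) Cf Uz).
rewrite mulr_sumr -sumrB mulr_suml; apply: eq_bigr => i _; rewrite mxE /dz.
move: (dirder (ebase R i) f z) (dirder ('i%C *: ebase R i) f z) => p q.
rewrite {1}[v 0 i]complexE (mulrC 'i%C (v 0 i)) ReiNIm ImiRe rmorphN /=.
move: (Re _)%:C (Im _)%:C => a b.
have -> : (a + 'i%C * b) * ((p - 'i%C * q) / 2) =
   (a * p + 'i%C * b * p - 'i%C * a * q - ('i%C * 'i%C) * b * q) / 2 by ring.
have -> : a * p + b * q - 'i%C * (- b * p + a * q) =
   a * p + 'i%C * b * p - 'i%C * a * q + b * q by ring.
by rewrite sqr_iC; ring.
Qed.

(** The (0,1) part of the derivative along v. *)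
Lemma sum_dzbar f v z : Ck U 1 f -> U z ->
  \sum_i Num.conj (v 0 i) * dzbar i f z =
  (dirder v f z + 'i%C * dirder ('i%C *: v) f z) / 2.
Proof.
move=> Cf Uz; rewrite (dirderEbase v Cf Uz) (dirderEbase ('i%C *: v) Cf Uz).
rewrite mulr_sumr -big_split mulr_suml; apply: eq_bigr => i _; rewrite mxE /dzbar.
move: (dirder (ebase R i) f z) (dirder ('i%C *: ebase R i) f z) => p q /=.
have -> : Num.conj (v 0 i) = (Re (v 0 i))%:C - 'i%C * (Im (v 0 i))%:C.
  by case: (v 0 i) => x y; rewrite conj_conjc /=; simpc.
rewrite (mulrC 'i%C (v 0 i)) ReiNIm ImiRe rmorphN /=.
move: (Re _)%:C (Im _)%:C => a b.
have -> : (a - 'i%C * b) * ((p + 'i%C * q) / 2) =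
   (a * p - 'i%C * b * p + 'i%C * a * q - ('i%C * 'i%C) * b * q) / 2 by ring.
have -> : a * p + b * q + 'i%C * (- b * p + a * q) =
   a * p - 'i%C * b * p + 'i%C * a * q + b * q by ring.
by rewrite sqr_iC; ring.
Qed.

Lemma Ck_dzbar k (j : 'I_n) f : Ck U k.+1 f -> Ck U k (dzbar j f).
Proof.
move=> Cf; apply: (CkM oU _ (Ck_cst oU k 2^-1)); apply: (CkD oU).
  exact: Ck_dirder_Ck.
by apply: (CkM oU (Ck_cst oU k 'i%C)); exact: Ck_dirder_Ck.
Qed.

Lemma dirder_lincomb (J : Type) (r : seq J) (c : J -> C) (F : J -> Cn -> C) v z :
  (forall j, Ck U 1 (F j)) -> U z ->
  dirder v (fun w => \sum_(j <- r) c j * F j w) z =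
  \sum_(j <- r) c j * dirder v (F j) z.
Proof.
move=> CF Uz; apply: dirderE; elim: r => [|j r IH].
  rewrite big_nil; apply: has_dirder_near (has_dirder_cst v 0 z).
  by near=> w; rewrite big_nil.
rewrite big_cons.
have H := has_dirderD (has_dirderZ (c := c j) (Ck_dirder (v := v) (CF j) Uz)) IH.
apply: (has_dirder_near _ H).
by near=> w; rewrite big_cons.
Unshelve. all: by end_near. Qed.

Lemma eq_dirder f g v z : (forall w, U w -> f w = g w) -> Ck U 1 f -> U z ->
  dirder v f z = dirder v g z.
Proof.
move=> fg Cf Uz; apply/esym/dirderE.
apply: has_dirder_near (Ck_dirder (v := v) Cf Uz).
exact: (near_open oU (P := fun w => f w = g w)).
Qed.

(** Composition of [sum_dz] and [sum_dzbar]. The last term is a commutator of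
    derivations times the imaginary unit: for a real function it drops out of the
    real part. *)
Lemma levi_form f v z : Ck U 2 f -> U z ->
  \sum_i \sum_j v 0 i * Num.conj (v 0 j) * dz i (dzbar j f) z =
  (dirder v (dirder v f) z + dirder ('i%C *: v) (dirder ('i%C *: v) f) z
   + 'i%C * (dirder v (dirder ('i%C *: v) f) z -
             dirder ('i%C *: v) (dirder v f) z)) / 4.
Proof.
move=> Cf Uz; have C1 j : Ck U 1 (dzbar j f) by exact: Ck_dzbar.
have Cv w : Ck U 1 (dirder w f) by exact: Ck_dirder_Ck.
rewrite exchange_big /=.
under eq_bigr => j _.
  under eq_bigr => i _ do rewrite mulrAC mulrC.
  rewrite -mulr_sumr (sum_dz v (C1 j) Uz) mulrA mulrBr; over.
rewrite -mulr_suml sumrB.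
have H w : \sum_j Num.conj (v 0 j) * dirder w (dzbar j f) z =
    (dirder w (dirder v f) z + 'i%C * dirder w (dirder ('i%C *: v) f) z) / 2.
  rewrite -(dirder_lincomb _ _ _ C1 Uz).
  rewrite -(@eq_dirder (fun y => 2^-1 * dirder v f y +
     2^-1 * 'i%C * dirder ('i%C *: v) f y)); last exact: Uz.
  - apply: dirderE.
    have H := has_dirderD (has_dirderZ (c := 2^-1) (Ck_dirder (v := w) (Cv v) Uz))
      (has_dirderZ (c := 2^-1 * 'i%C) (Ck_dirder (v := w) (Cv ('i%C *: v)) Uz)).
    refine (has_rder_eqd _ H).
    by move: (dirder w (dirder v f) z) (dirder w _ z) => p q; ring.
  - move=> y Uy; rewrite (sum_dzbar v (Ck_pred oU Cf) Uy).
    by move: (dirder v f y) (dirder _ f y) => p q; ring.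
  - by apply: (CkD oU); apply: (CkM oU (Ck_cst oU 1 _)); exact: Cv.
rewrite (H v) (_ : \sum_j Num.conj (v 0 j) * ('i%C * dirder ('i%C *: v) (dzbar j f) z) =
    'i%C * ((dirder ('i%C *: v) (dirder v f) z +
             'i%C * dirder ('i%C *: v) (dirder ('i%C *: v) f) z) / 2)); last first.
  by rewrite -H mulr_sumr; apply: eq_bigr => j _; rewrite mulrCA.
move: (dirder v (dirder v f) z) (dirder v (dirder ('i%C *: v) f) z) => p q.
move: (dirder ('i%C *: v) (dirder v f) z) (dirder ('i%C *: v) (dirder ('i%C *: v) f) z) => r s.
have -> : ((p + 'i%C * q) / 2 - 'i%C * ((r + 'i%C * s) / 2)) / 2 =
  (p + 'i%C * q - 'i%C * r - ('i%C * 'i%C) * s) / 4 by field.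
by rewrite sqr_iC; congr (_ / _); ring.
Qed.

Definition real_valued f := forall z, U z -> Im (f z) = 0.

Lemma dirder_real f v : Ck U 1 f -> real_valued f -> real_valued (dirder v f).
Proof.
move=> Cf rf z Uz; have fd := Ck_dirder (v := v) Cf Uz.
have [_ <-] := is_derive_Im fd.
rewrite (@near_eq_derive _ _ _ _ (cst 0)) ?derive_cst//.
have := near_line v (open_nbhs_nbhs (conj oU Uz)).
by apply: filterS => s /rf.
Qed.

Lemma dirder2_max f v z : Ck U 2 f -> U z ->
  (forall w, U w -> Re (f w) <= Re (f z)) -> Re (dirder v (dirder v f) z) <= 0.
Proof.
move=> Cf Uz fmax; have C1 : Ck U 1 f by exact: Ck_pred.
have C1' : Ck U 1 (dirder v f) by exact: Ck_dirder_Ck.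
have nU := near_line v (open_nbhs_nbhs (conj oU Uz)).
apply: (@second_derivative_le0 _ (fun s => Re (f (z + s%:C *: v)))
   (fun s => Re (dirder v f (z + s%:C *: v)))).
- apply: filterS nU => s Us; apply: is_derive_Re.
  by apply: has_rder_line; exact: Ck_dirder C1 Us.
- apply: is_derive_Re; exact: (Ck_dirder (v := v) C1' Uz).
- by apply: filterS nU => s Us; rewrite line0 fmax.
Qed.

(** On a complex line through a maximum both real second derivatives are
    nonpositive. *)
Lemma levi_form_max f v z : Ck U 2 f -> real_valued f -> U z ->
  (forall w, U w -> Re (f w) <= Re (f z)) ->
  Re (\sum_i \sum_j v 0 i * Num.conj (v 0 j) * dz i (dzbar j f) z) <= 0.
Proof.
move=> Cf rf Uz fmax; rewrite (levi_form v Cf Uz).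
have C1 w : Ck U 1 (dirder w f) by exact: Ck_dirder_Ck.
have r1 w := dirder_real w (Ck_pred oU Cf) rf.
have r2 w y : Im (dirder w (dirder y f) z) = 0.
  exact: (dirder_real w (C1 y) (r1 y) Uz).
have := dirder2_max v Cf Uz fmax; have := dirder2_max ('i%C *: v) Cf Uz fmax.
have := r2 v ('i%C *: v); have := r2 ('i%C *: v) v.
move: (dirder v (dirder v f) z) (dirder v (dirder ('i%C *: v) f) z) => p q.
move: (dirder ('i%C *: v) (dirder v f) z) (dirder ('i%C *: v) (dirder ('i%C *: v) f) z) => r s.
move=> r0 q0 s0 p0.
have -> : (4 : C)^-1 = (4^-1 : R)%:C by rewrite fmorphV rmorph_nat.
(* the commutator term is 'i times a real number *)
rewrite [X in Re X]mulrC Re_rM ReD (ReD p) (mulrC 'i%C) ReiNIm ImD ImN r0 q0.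
by rewrite subrr subr0 pmulr_rle0 ?invr_gt0// -[leRHS]addr0 lerD.
Qed.

End LinearDirection.

(** * Positive matrices and forms on the Hopf manifold *)

Section Matrices.
Variables (R : realType) (n : nat).
Local Notation C := R[i].
Local Notation Cn := 'rV[R[i]]_n.

Lemma quad_formE (A : 'M[C]_n) (v : Cn) :
  (v *m A *m adjmx v) 0 0 = \sum_i \sum_j v 0 i * A i j * Num.conj (v 0 j).
Proof.
rewrite mxE exchange_big /=; apply: eq_bigr => j _.
by rewrite !mxE mulr_suml.
Qed.

(** Both sides are the determinant of the block matrix with rows (1 + uv, u) and
    (0, 1), up to multiplication by unipotent block matrices. *)
Lemma det_add1_mul (u : 'cV[C]_n) (v : 'rV[C]_n) :
  \det (1%:M + u *m v) = 1 + (v *m u) 0 0.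
Proof.
have E : block_mx 1%:M 0 v 1%:M *m block_mx (1%:M + u *m v) u 0 1%:M *m
    block_mx 1%:M 0 (- v) 1%:M = block_mx 1%:M u 0 (1%:M + v *m u).
  rewrite !mulmx_block !(mul1mx, mulmx1, mul0mx, mulmx0, addr0, add0r).
  rewrite mulmxN addrK mulmxDr mulmx1 mulmxA mulmxN mulmxDl mul1mx.
  by rewrite [v + _]addrC subrr [v *m u + _]addrC.
move: (congr1 determinant E).
rewrite !det_mulmx !det_ublock !det_lblock !det1 !(mul1r, mulr1) => ->.
by rewrite det_mx11 !mxE eqxx.
Qed.

(** By the spectral theorem the determinant is a product of values of the form on
    unit vectors. *)
Lemma posdef_det_gt0 (A : 'M[C]_n) : posdefmx A -> 0 < \det A.
Proof.
move=> [Aadj Apos].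
have Aherm : A \is hermsymmx.
  by apply/is_hermitianmxP; rewrite expr0 scale1r [LHS]Aadj.
have /orthomx_spectralP := hermitian_normalmx Aherm.
have := spectral_unitarymx A.
move: (spectralmx A) (spectral_diag A) => P D Pu AE.
have Punit := unitarymx_unit Pu.
have DE : diag_mx D = P *m A *m adjmx P.
  have -> : adjmx P = invmx P by rewrite invmx_unitary.
  rewrite AE !mulmxA mulmxV// mul1mx.
  by rewrite -mulmxA mulmxV// mulmx1.
have -> : \det A = \det (diag_mx D).
  by rewrite AE !det_mulmx det_inv mulrC mulrA divrr ?mul1r// -unitmxE.
rewrite det_diag prodr_gt0// => i _.
have -> : D 0 i = (row i P *m A *m adjmx (row i P)) 0 0.
  have /matrixP/(_ i i) := DE; rewrite mxE eqxx mulr1n => ->.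
  rewrite -row_mul !mxE; apply: eq_bigr => j _.
  by rewrite !mxE.
apply: Apos; apply/eqP => Pi0.
have := row_free_unit P; rewrite Punit => /row_freeP[Q /(congr1 (row i))].
rewrite row_mul Pi0 mul0mx => /rowP/(_ i); rewrite !mxE eqxx => /esym/eqP.
by rewrite oner_eq0.
Qed.

End Matrices.

Arguments has_dirder_coord {R n} v z i.

Section HopfForms.
Variables (R : realType) (n : nat) (alpha : 'rV[R[i]]_n).
Hypothesis halpha : hopf_param alpha.
Local Notation C := R[i].
Local Notation Cn := 'rV[R[i]]_n.
Local Notation Re := (@complex.Re R).
Local Notation Im := (@complex.Im R).
Local Notation M := (hopf_manifold halpha).

(** Two charts differ locally by a single deck transformation. *)
Lemma hopf_trans_near (c d : chart M) (z : Cn) (k : int) : dom c z ->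
  dom d (alpha_act alpha k z) ->
  \forall z' \near z, trans c d z' = alpha_act alpha k z'.
Proof.
move=> cz dz; near=> z'.
have cz' : hopf_dom c z'.
  by near: z'; apply: open_nbhs_nbhs; split=> //; exact: hopf_dom_open.
have dz' : hopf_dom d (alpha_act alpha k z').
  near: z'; apply: (@continuous_alpha_act R n alpha halpha k z (hopf_dom d)).
  by apply: open_nbhs_nbhs; split=> //; exact: hopf_dom_open.
have e : hopf_proj halpha (alpha_act alpha k z') = hopf_proj halpha z'.
  by apply/esym/hopf_projP; [exact: hopf_dom_neq0 cz'|exact: hopf_dom_neq0 dz'|exists k].
rewrite /trans /=; case: xgetP => [y _ [dy ye]|/(_ (alpha_act alpha k z'))]; last by case.
by apply: (hopf_dom_inj dy dz'); rewrite ye.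
Unshelve. all: by end_near. Qed.

Lemma hopf_jacobian (c d : chart M) (z : Cn) (k : int) : dom c z ->
  dom d (alpha_act alpha k z) ->
  'J (trans c d) z = diag_mx (\row_i alpha 0 i ^ k).
Proof.
move=> cz dz; have nt := hopf_trans_near cz dz.
have dt : differentiable (trans c d) z.
  by apply: near_differentiable nt _; exact: differentiable_alpha_act.
apply/row_matrixP => i; rewrite !rowE -deriveEjacobian//.
rewrite (near_eq_derive _ nt) deriveE; last exact: differentiable_alpha_act.
rewrite diff_lin; last exact: continuous_alpha_act.
exact: alpha_act_diag.
Qed.

Lemma hopf_overlapP (c d : chart M) (z : Cn) : overlap c d z <->
  exists k, dom c z /\ dom d (alpha_act alpha k z).
Proof.
split=> [[cz [w dw e]]|[k [cz dz]]].
  have z0 := hopf_dom_neq0 cz; have w0 := hopf_dom_neq0 dw.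
  have [k wE] : exists k, w = alpha_act alpha k z by apply/(hopf_projP halpha).
  by exists k; rewrite -wE.
split=> //; exists (alpha_act alpha k z) => //.
apply/esym/hopf_projP; [exact: hopf_dom_neq0 cz|exact: hopf_dom_neq0 dz|by exists k].
Qed.

(** The transition maps are the diagonal linear maps z |-> alpha^k z, so a (1,1)
    form on the Hopf manifold is a family of matrices with this invariance. The
    case k = 0 says that the coefficients do not depend on the chart. *)
Lemma form11P (g : coefs M) : is_form11 g <->
  forall (c d : chart M) (z : Cn) (k : int), dom c z -> dom d (alpha_act alpha k z) ->
  forall i j, g c z i j =
    alpha 0 i ^ k * g d (alpha_act alpha k z) i j * Num.conj (alpha 0 j ^ k).
Proof.
have E (c d : chart M) (z : Cn) (k : int) :  dom c z -> dom d (alpha_act alpha k z) ->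
    (g c z = 'J (trans c d) z *m g d (trans c d z) *m adjmx ('J (trans c d) z)) <->
    (forall i j, g c z i j =
    alpha 0 i ^ k * g d (alpha_act alpha k z) i j * Num.conj (alpha 0 j ^ k)).
  move=> cz dz; rewrite (hopf_jacobian cz dz) (nbhs_singleton (hopf_trans_near cz dz)).
  have F i j : (diag_mx (\row_i alpha 0 i ^ k) *m g d (alpha_act alpha k z) *m
      adjmx (diag_mx (\row_i alpha 0 i ^ k))) i j =
      alpha 0 i ^ k * g d (alpha_act alpha k z) i j * Num.conj (alpha 0 j ^ k).
    by rewrite /adjmx tr_diag_mx map_diag_mx mul_diag_mx mul_mx_diag !mxE.
  by split=> [-> //|H]; apply/matrixP => i j; rewrite H -F.
split=> [gf c d z k cz dz|H c d z /hopf_overlapP[k [cz dz]]].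
  by apply/(E c d z k cz dz); apply: gf; apply/hopf_overlapP; exists k.
by apply/(E c d z k cz dz); exact: H.
Qed.

Definition Cn0 : set Cn := [set z | z != 0].

Lemma open_Cn0 : open Cn0.
Proof.
rewrite (_ : Cn0 = ~` [set 0]); last by apply/seteqP; split=> z /eqP.
apply: closed_openC; apply: accessible_closed_set1.
exact: hausdorff_accessible (@norm_hausdorff _ _).
Qed.

Lemma rsqE (z : Cn) : rsq z = \sum_j z 0 j * Num.conj (z 0 j).
Proof. by apply: eq_bigr => j _; rewrite normCK. Qed.

Lemma rsq_gt0 (z : Cn) : z != 0 -> 0 < rsq z.
Proof.
move=> z0; rewrite lt_def sumr_ge0 ?andbT; last by move=> j _; rewrite exprn_ge0.
apply: contraNneq z0 => /psumr_eq0P H; apply/eqP/rowP => j; rewrite mxE.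
have /eqP := H (fun i _ => exprn_ge0 2 (normr_ge0 (z 0 i))) j isT.
by rewrite expf_eq0 /= normr_eq0 => /eqP.
Qed.

Lemma rsq_neq0 (z : Cn) : z != 0 -> rsq z != 0.
Proof. by move=> /rsq_gt0 /lt0r_neq0. Qed.

Lemma Ck_rsq (U : set Cn) k : open U -> Ck U k (@rsq R n).
Proof.
move=> oU; apply: (Ck_eq oU (f := fun z => \sum_j z 0 j * Num.conj (z 0 j))).
  by move=> z _; rewrite rsqE.
apply: (Ck_sum oU) => j _; apply: (CkM oU); first exact: Ck_coord.
by apply: (Ck_conj oU); exact: Ck_coord.
Qed.

Lemma Ck_rsqV k : Ck Cn0 k (fun z => (rsq z)^-1).
Proof. by apply: (CkV open_Cn0) => [z /rsq_neq0//|]; exact/Ck_rsq/open_Cn0. Qed.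

(** The derivative of r^2 along v. *)
Definition drsq (v z : Cn) : C :=
  \sum_j (v 0 j * Num.conj (z 0 j) + z 0 j * Num.conj (v 0 j)).

Lemma has_dirder_rsq (v z : Cn) : has_dirder v (@rsq R n) z (drsq v z).
Proof.
have H (r : seq 'I_n) : has_dirder v (fun w => \sum_(j <- r) w 0 j * Num.conj (w 0 j)) z
    (\sum_(j <- r) (v 0 j * Num.conj (z 0 j) + z 0 j * Num.conj (v 0 j))).
  elim: r => [|j r IH].
    rewrite big_nil; apply: has_rder_eq (has_dirder_cst v 0 z) => s.
    by rewrite big_nil.
  rewrite big_cons; have cj := has_dirder_coord v z j.
  apply: has_rder_eq (has_dirderD (has_dirderM cj (has_dirder_conj cj)) IH) => s.
  by rewrite big_cons.
by apply: has_rder_eq (H _) => s; rewrite rsqE.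
Qed.
Arguments has_dirder_rsq : clear implicits.

Lemma drsq_ebase (j : 'I_n) (z : Cn) :
  drsq (ebase R j) z = Num.conj (z 0 j) + z 0 j.
Proof.
rewrite /drsq (bigD1 j)//= big1 ?addr0 => [|k kj]; rewrite !mxE eqxx /=.
  by rewrite conjC_nat eqxx mul1r mulr1.
by rewrite conjC_nat (negbTE kj) mul0r mulr0 addr0.
Qed.

Lemma conj_iC : Num.conj ('i%C : C) = - 'i%C.
Proof. by rewrite conj_conjc /=; simpc. Qed.

Lemma drsq_iebase (j : 'I_n) (z : Cn) :
  drsq ('i%C *: ebase R j) z = 'i%C * (Num.conj (z 0 j) - z 0 j).
Proof.
rewrite /drsq (bigD1 j)//= big1 ?addr0 => [|k kj]; rewrite !mxE eqxx /=.
  by rewrite eqxx mulr1 conj_iC; ring.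
by rewrite (negbTE kj) mulr0 rmorph0 mul0r mulr0 addr0.
Qed.

Lemma drsq_real (v z : Cn) : drsq v z \is Num.real.
Proof.
apply: rpred_sum => j _; rewrite CrealE rmorphD !rmorphM /= !conjCK addrC.
by rewrite mulrC [X in _ + X]mulrC.
Qed.

Lemma dzE (j : 'I_n) f (z : Cn) (p q : C) : has_dirder (ebase R j) f z p ->
  has_dirder ('i%C *: ebase R j) f z q -> dz j f z = (p - 'i%C * q) / 2.
Proof. by move=> /dirderE fp /dirderE fq; rewrite /dz fp fq. Qed.

Lemma dzbarE (j : 'I_n) f (z : Cn) (p q : C) : has_dirder (ebase R j) f z p ->
  has_dirder ('i%C *: ebase R j) f z q -> dzbar j f z = (p + 'i%C * q) / 2.
Proof. by move=> /dirderE fp /dirderE fq; rewrite /dzbar fp fq. Qed.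

Lemma eq_dz (j : 'I_n) f g (U : set Cn) (z : Cn) : open U ->
  (forall w, U w -> f w = g w) -> Ck U 1 f -> U z -> dz j f z = dz j g z.
Proof.
by move=> oU fg Cf Uz; rewrite /dz !(eq_dirder oU _ fg Cf Uz).
Qed.

Lemma eq_dzbar (j : 'I_n) f g (U : set Cn) (z : Cn) : open U ->
  (forall w, U w -> f w = g w) -> Ck U 1 f -> U z -> dzbar j f z = dzbar j g z.
Proof.
by move=> oU fg Cf Uz; rewrite /dzbar !(eq_dirder oU _ fg Cf Uz).
Qed.

Definition ln_rsq (z : Cn) : C := (ln (Re (rsq z)))%:C.

Lemma Ck_ln_rsq k : Ck Cn0 k ln_rsq.
Proof.
apply: (Ck_ln open_Cn0) => [z|]; first exact: rsq_gt0.
exact/Ck_rsq/open_Cn0.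
Qed.

Lemma has_dirder_ln_rsq (v z : Cn) : z != 0 ->
  has_dirder v ln_rsq z (drsq v z / rsq z).
Proof.
move=> z0; have H := has_dirder_ln (rsq_gt0 z0) (has_dirder_rsq v z).
refine (has_rder_eqd _ H).
rewrite rmorphM /= fmorphV /= RRe_real ?drsq_real//.
by have [<- _] := gt0_complex_real (rsq_gt0 z0).
Qed.
Arguments has_dirder_ln_rsq v {z}.

Lemma dzbar_ln_rsq (j : 'I_n) (z : Cn) : z != 0 -> dzbar j ln_rsq z = z 0 j / rsq z.
Proof.
move=> z0; rewrite (dzbarE (has_dirder_ln_rsq _ z0) (has_dirder_ln_rsq _ z0)).
rewrite drsq_ebase drsq_iebase mulrA mulrA sqr_iC -mulrDl mulrAC; congr (_ / _).
by field.
Qed.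

(** The coefficients of omega_T. *)
Definition rank1 (i j : 'I_n) (z : Cn) : C := Num.conj (z 0 i) * z 0 j / rsq z ^+ 2.

(** The complex Hessian of log r^2. *)
Lemma levi_ln_rsq (i j : 'I_n) (z : Cn) : z != 0 ->
  dz i (dzbar j ln_rsq) z = (i == j)%:R / rsq z - rank1 i j z.
Proof.
move=> z0.
rewrite -(@eq_dz i (fun w => w 0 j / rsq w) _ _ _ open_Cn0).
- have H (v : Cn) := has_dirderM (has_dirder_coord v z j)
    (has_dirderV (rsq_neq0 z0) (has_dirder_rsq v z)).
  rewrite (dzE (H _) (H _)) drsq_ebase drsq_iebase !mxE eqxx /= /rank1 (eq_sym j).
  move: (rsq z) (rsq_neq0 z0) => r r0; move: (z 0 j) => a.
  move: (Num.conj (z 0 i)) => b; move: (z 0 i) => c.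
  move: (i == j)%:R => e.
  have -> : e / r + a * - ((b + c) / (r * r)) -
    'i%C * ('i%C * e / r + a * - ('i%C * (b - c) / (r * r))) =
    e / r - a * (b + c) / (r * r) - ('i%C * 'i%C) * (e / r - a * (b - c) / (r * r)) by ring.
  by rewrite sqr_iC; field.
- by move=> w w0; rewrite dzbar_ln_rsq.
- by apply: (CkM open_Cn0); [exact/Ck_coord/open_Cn0|exact: Ck_rsqV].
- exact: z0.
Qed.

Lemma det_omegaH (c : chart M) (z : Cn) : \det (omegaH halpha c z) = (rsq z)^-1 ^+ n.
Proof.
rewrite -det_scalar; congr (\det _); apply/matrixP => i j; rewrite !mxE.
by case: eqP; rewrite ?mul0r ?mul1r.
Qed.

Lemma ln_det_omegaH (c : chart M) (z : Cn) : z != 0 ->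
  (ln (Re (\det (omegaH halpha c z))))%:C = - n%:R * ln_rsq z.
Proof.
move=> z0; rewrite det_omegaH; have [rE r0] := gt0_complex_real (rsq_gt0 z0).
rewrite {1}rE -fmorphV -rmorphXn /= lnXn ?invr_gt0// lnV ?posrE//.
by rewrite rmorphMn rmorphN /= mulNr mulr_natl mulNrn.
Qed.

End HopfForms.

(** * The Chern-Ricci form along the affine path *)

Section HopfFlow.
Variables (R : realType) (n : nat) (alpha : 'rV[R[i]]_n).
Hypothesis halpha : hopf_param alpha.
Local Notation C := R[i].
Local Notation Cn := 'rV[R[i]]_n.
Local Notation Re := (@complex.Re R).
Local Notation Im := (@complex.Im R).
Local Notation M := (hopf_manifold halpha).
Local Notation U0 := (@Cn0 R n).

Lemma dom_Cn0 (c : chart M) (z : Cn) : dom c z -> z != 0.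
Proof. exact: hopf_dom_neq0. Qed.

Lemma dz_affine (i : 'I_n) (U : set Cn) (a c : C) f z : open U -> Ck U 1 f -> U z ->
  dz i (fun w => a + c * f w) z = c * dz i f z.
Proof.
move=> oU Cf Uz.
have H v : has_dirder v (fun w => a + c * f w) z (c * dirder v f z).
  have H := has_dirderD (has_dirder_cst v a z)
    (has_dirderZ (c := c) (Ck_dirder (v := v) Cf Uz)).
  by refine (has_rder_eqd _ H); rewrite add0r.
rewrite (dzE (H _) (H _)) /dz.
by move: (dirder (ebase R i) f z) (dirder ('i%C *: ebase R i) f z) => p q; ring.
Qed.

Lemma dzbar_affine (i : 'I_n) (U : set Cn) (a c : C) f z : open U -> Ck U 1 f -> U z ->
  dzbar i (fun w => a + c * f w) z = c * dzbar i f z.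
Proof.
move=> oU Cf Uz.
have H v : has_dirder v (fun w => a + c * f w) z (c * dirder v f z).
  have H := has_dirderD (has_dirder_cst v a z)
    (has_dirderZ (c := c) (Ck_dirder (v := v) Cf Uz)).
  by refine (has_rder_eqd _ H); rewrite add0r.
rewrite (dzbarE (H _) (H _)) /dzbar.
by move: (dirder (ebase R i) f z) (dirder ('i%C *: ebase R i) f z) => p q; ring.
Qed.

(** The coefficients of omega_H. *)
Definition conformal (i j : 'I_n) (z : Cn) : C := (i == j)%:R / rsq z.

Lemma levi_affine_ln_rsq (a c : C) f (i j : 'I_n) (z : Cn) :
  (forall w, w != 0 -> f w = a + c * ln_rsq w) -> z != 0 ->
  dz i (dzbar j f) z = c * (conformal i j z - rank1 i j z).
Proof.
move=> fE z0; have oU := @open_Cn0 R n.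
have Cg k : Ck U0 k (fun w => a + c * ln_rsq w).
  apply: (CkD oU (Ck_cst oU k a)); apply: (CkM oU (Ck_cst oU k c)).
  exact: Ck_ln_rsq.
have Cf k : Ck U0 k f by apply: (Ck_eq oU _ (Cg k)) => w w0; rewrite fE.
rewrite (@eq_dz R n i _ (fun w => 0 + c * dzbar j (@ln_rsq R n) w) U0 z oU).
- rewrite (dz_affine _ _ _ oU _ z0); first by rewrite levi_ln_rsq.
  by apply: (Ck_dzbar oU); exact: Ck_ln_rsq.
- move=> w w0; rewrite add0r (eq_dzbar _ oU _ (Cf 1%N) w0 (g := fun w => a + c * ln_rsq w)).
    by rewrite (dzbar_affine _ _ _ oU _ w0)//; exact: Ck_ln_rsq.
  by move=> y y0; rewrite fE.
- exact: (Ck_dzbar oU).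
- exact: z0.
Qed.

(** A constant factor of the determinant is invisible to the Chern-Ricci form. *)
Lemma chern_ricci_conformal (g : coefs M) (c : chart M) (z : Cn) (a : R) (i j : 'I_n) :
  0 < a -> (forall w, w != 0 -> \det (g c w) = a%:C * (rsq w)^-1 ^+ n) ->
  z != 0 -> chern_ricci g c z i j = n%:R * (conformal i j z - rank1 i j z).
Proof.
move=> a0 gE z0; rewrite mxE.
rewrite (@levi_affine_ln_rsq (ln a)%:C (- n%:R) _ i j z) ?mulNr ?opprK//.
move=> w w0; rewrite gE// -(ln_det_omegaH c w0) det_omegaH Re_rM.
rewrite lnM ?posrE//; first by rewrite rmorphD.
have [rE r0] := gt0_complex_real (rsq_gt0 w0).
by rewrite rE -fmorphV -rmorphXn /= exprn_gt0 ?invr_gt0.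
Qed.

(** The coefficients of - Ric(omega_H), the constant speed of the affine path. *)
Definition drift (i j : 'I_n) (z : Cn) : C :=
  n%:R * (rank1 i j z - conformal i j z).

Lemma chern_ricci_omegaH (c : chart M) (z : Cn) (i j : 'I_n) : z != 0 ->
  chern_ricci (omegaH halpha) c z i j = - drift i j z.
Proof.
move=> z0; have -> : - drift i j z = n%:R * (conformal i j z - rank1 i j z).
  by rewrite /drift -mulrN opprB.
apply: (chern_ricci_conformal i j ltr01) z0 => w w0.
by rewrite det_omegaH mul1r.
Qed.

Lemma hopf_flowE (t : R) (c : chart M) (z : Cn) (i j : 'I_n) : z != 0 ->
  hopf_flow halpha t c z i j = conformal i j z + t%:C * drift i j z.
Proof.
by move=> z0; rewrite mxE [X in _ + X]mxE [X in _ - X]mxE chern_ricci_omegaH// mulrN opprK mxE.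
Qed.

Lemma det_hopf_flow (t : R) (c : chart M) (w : Cn) : 0 < 1 - n%:R * t -> w != 0 ->
  \det (hopf_flow halpha t c w) =
  ((1 - n%:R * t) ^+ n / (1 - n%:R * t))%:C * (rsq w)^-1 ^+ n.
Proof.
move=> a0 w0; set a := 1 - n%:R * t.
have aC : a%:C != 0 by apply: real_complex_neq0; rewrite gt_eqF.
have r0 := rsq_neq0 w0.
have -> : hopf_flow halpha t c w = (a%:C / rsq w) *: (1%:M +
    ((n%:R * t%:C / (a%:C * rsq w)) *: adjmx w) *m w).
  apply/matrixP => i j; rewrite hopf_flowE// /drift /conformal /rank1 !mxE big_ord1 !mxE.
  have tE : n%:R * t%:C = 1 - a%:C by rewrite /a rmorphB rmorphM /= rmorph_nat rmorph1; ring.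
  move: aC r0 tE; move: (rsq w) => r; move: a%:C => b; move: t%:C => s b0 r0 tE.
  have -> : s * (n%:R * (Num.conj (w 0 i) * w 0 j / r ^+ 2 - (i == j)%:R / r)) =
    (n%:R * s) * (Num.conj (w 0 i) * w 0 j / r ^+ 2 - (i == j)%:R / r) by ring.
  rewrite tE; case: eqP => _ /=; field; by rewrite b0 r0.
rewrite detZ det_add1_mul -scalemxAr mxE [X in _ * (1 + _ * X)](_ : _ = rsq w); last first.
  by rewrite rsqE mxE; apply: eq_bigr => i _; rewrite !mxE.
rewrite [X in _ * X](_ : _ = a%:C^-1).
  by rewrite !exprMn rmorphM rmorphXn /= fmorphV mulrAC exprVn.
have -> : n%:R = (n%:R : R)%:C :> C by rewrite rmorph_nat.
rewrite -rmorphM /= (_ : n%:R * t = 1 - a); last by rewrite /a; ring.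
by rewrite rmorphB rmorph1 /=; field; rewrite aC r0.
Qed.

Lemma chern_ricci_hopf_flow (t : R) (c : chart M) (z : Cn) (i j : 'I_n) :
  0 < 1 - n%:R * t -> z != 0 ->
  chern_ricci (hopf_flow halpha t) c z i j = - drift i j z.
Proof.
move=> t0 z0; have -> : - drift i j z = n%:R * (conformal i j z - rank1 i j z).
  by rewrite /drift -mulrN opprB.
have k0 : 0 < (1 - n%:R * t) ^+ n / (1 - n%:R * t) by rewrite divr_gt0// exprn_gt0.
apply: (chern_ricci_conformal i j k0) z0 => w w0.
exact: det_hopf_flow.
Qed.

Lemma Ck_conformal (i j : 'I_n) k : Ck U0 k (conformal i j).
Proof.
have oU := @open_Cn0 R n; apply: (CkM oU (Ck_cst oU k _)); exact: Ck_rsqV.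
Qed.

Lemma Ck_rank1 (i j : 'I_n) k : Ck U0 k (rank1 i j).
Proof.
have oU := @open_Cn0 R n; have Cc l := Ck_coord oU k l.
apply: (CkM oU).
  by apply: (CkM oU (Ck_conj oU (Cc i)) (Cc j)).
apply: (Ck_eq oU (f := fun z => (rsq z)^-1 * (rsq z)^-1)).
  by move=> z _; rewrite expr2 invfM.
by apply: (CkM oU); exact: Ck_rsqV.
Qed.

Lemma Ck_drift (i j : 'I_n) k : Ck U0 k (drift i j).
Proof.
have oU := @open_Cn0 R n; apply: (CkM oU (Ck_cst oU k _)).
apply: (CkD oU (Ck_rank1 i j k)); apply: (CkN oU); exact: Ck_conformal.
Qed.

Lemma Ck_sub (U V : set Cn) k f : V `<=` U -> Ck U k f -> Ck V k f.
Proof.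
move=> VU; elim: k f => [|k IH] f [cf Hf].
  by split; first by move=> z Vz; exact: cf (VU _ Vz).
split; first by move=> z Vz; exact: cf (VU _ Vz).
have [df Cdf] := Hf; split; first by move=> v z Vz; exact: df v z (VU _ Vz).
by move=> v; exact: IH (Cdf v).
Qed.

(** All |alpha_i| are equal: this is what makes omega_H and omega_T invariant. *)
Lemma alpha_pow_norm (k : int) : exists2 rho : C, rho != 0 &
  forall i, alpha 0 i ^ k * Num.conj (alpha 0 i ^ k) = rho.
Proof.
have [i0 _] := alpha_index halpha.
exists (alpha 0 i0 ^ k * Num.conj (alpha 0 i0 ^ k)).
  by rewrite mulf_neq0 ?conjC_eq0 ?expfz_neq0 ?alpha_neq0.
have [_ eqa _] := halpha.
have E i : alpha 0 i ^ k * Num.conj (alpha 0 i ^ k) = (`|alpha 0 i| ^ k) ^+ 2.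
  by rewrite -normCK; case: k => k; rewrite ?NegzE -?exprnN ?normfV ?exprnP -?exprnP normrX.
by move=> i; rewrite !E (eqa i i0).
Qed.

Lemma rsq_alpha_act (k : int) (rho : C) z :
  (forall i, alpha 0 i ^ k * Num.conj (alpha 0 i ^ k) = rho) ->
  rsq (alpha_act alpha k z) = rho * rsq z.
Proof.
move=> H; rewrite !rsqE mulr_sumr; apply: eq_bigr => i _; rewrite !mxE -(H i).
by rewrite rmorphM /=; ring.
Qed.

Lemma conformal_act (k : int) (z : Cn) i j : z != 0 ->
  conformal i j z =
  alpha 0 i ^ k * conformal i j (alpha_act alpha k z) * Num.conj (alpha 0 j ^ k).
Proof.
move=> z0; have [rho rho0 rhoE] := alpha_pow_norm k.
rewrite /conformal (rsq_alpha_act _ rhoE).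
have [<-|ij] := eqVneq i j; last by rewrite !(mulr0, mul0r).
rewrite mulrAC rhoE; field; by rewrite rho0 rsq_neq0.
Qed.

Lemma rank1_act (k : int) (z : Cn) i j : z != 0 ->
  rank1 i j z =
  alpha 0 i ^ k * rank1 i j (alpha_act alpha k z) * Num.conj (alpha 0 j ^ k).
Proof.
move=> z0; have [rho rho0 rhoE] := alpha_pow_norm k.
rewrite /rank1 (rsq_alpha_act _ rhoE) !mxE rmorphM /=.
transitivity ((alpha 0 i ^ k * Num.conj (alpha 0 i ^ k)) * (alpha 0 j ^ k * Num.conj (alpha 0 j ^ k))
   * (Num.conj (z 0 i) * z 0 j) / (rho * rsq z) ^+ 2); last by ring.
by rewrite !rhoE; field; rewrite rho0 rsq_neq0.
Qed.

(** Coefficient functions on C^n minus the origin that are smooth and invariant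
    under the deck group define a smooth form. *)
Lemma smooth_form_invariant (g : coefs M) (G : 'I_n -> 'I_n -> Cn -> C) :
  (forall (c : chart M) z i j, z != 0 -> g c z i j = G i j z) ->
  (forall i j k, Ck U0 k (G i j)) ->
  (forall k z i j, z != 0 -> G i j z =
     alpha 0 i ^ k * G i j (alpha_act alpha k z) * Num.conj (alpha 0 j ^ k)) ->
  smooth_form g.
Proof.
move=> gE CG Gact; split.
  apply/form11P => c d z k cz dz i j.
  have z0 := dom_Cn0 cz; have w0 := dom_Cn0 dz.
  by rewrite !gE//; exact: Gact.
move=> c i j; have oc := @hopf_dom_open _ _ _ halpha c.
apply/(smooth_onP oc) => k.
apply: (Ck_eq oc (f := G i j)) => [z /dom_Cn0 z0|]; first by rewrite gE.
by apply: Ck_sub (CG i j k) => z /dom_Cn0.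
Qed.

Lemma drift_act (k : int) (z : Cn) i j : z != 0 ->
  drift i j z =
  alpha 0 i ^ k * drift i j (alpha_act alpha k z) * Num.conj (alpha 0 j ^ k).
Proof.
move=> z0; rewrite /drift (conformal_act k i j z0) (rank1_act k i j z0).
move: (conformal _ _ _) (rank1 _ _ _) => p q; ring.
Qed.

Lemma quad_conformal (v z : Cn) :
  \sum_i \sum_j v 0 i * conformal i j z * Num.conj (v 0 j) = rsq v / rsq z.
Proof.
rewrite rsqE mulr_suml; apply: eq_bigr => i _; rewrite (bigD1 i)//= big1 => [|j ji].
  by rewrite addr0 /conformal eqxx mul1r mulrAC.
by rewrite /conformal eq_sym (negbTE ji) mul0r mulr0 mul0r.
Qed.

Lemma quad_rank1 (v z : Cn) :
  \sum_i \sum_j v 0 i * rank1 i j z * Num.conj (v 0 j) =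
  `|\sum_i v 0 i * Num.conj (z 0 i)| ^+ 2 / rsq z ^+ 2.
Proof.
rewrite normCK rmorph_sum /= !mulr_suml; apply: eq_bigr => i _.
rewrite !mulr_sumr mulr_suml; apply: eq_bigr => j _.
by rewrite /rank1 rmorphM /= conjCK; ring.
Qed.

Lemma conformal_adj i j (z : Cn) : Num.conj (conformal j i z) = conformal i j z.
Proof.
rewrite /conformal rmorphM /= conjC_nat fmorphV /= eq_sym; congr (_ / _).
by rewrite conj_Creal// rsqE rpred_sum// => k _; rewrite -normCK rpredX// normr_real.
Qed.

Lemma rank1_adj i j (z : Cn) : Num.conj (rank1 j i z) = rank1 i j z.
Proof.
rewrite /rank1 !rmorphM /= conjCK fmorphV /= rmorphXn /= mulrC mulrA mulrC.
rewrite [X in X^-1 * _](_ : _ = rsq z ^+ 2); last first.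
  congr (_ ^+ 2); rewrite conj_Creal// rsqE rpred_sum// => k _.
  by rewrite -normCK rpredX// normr_real.
by rewrite (mulrC (rsq z ^- 2)) mulrA.
Qed.

(** omega_T is the square of the modulus of the linear form sum v_i conj(z_i),
    divided by r^4. *)
Lemma omegaT_form : nonneg_form (omegaT halpha).
Proof.
have TE (c : chart M) z i j : z != 0 -> omegaT halpha c z i j = rank1 i j z.
  by move=> _; rewrite mxE.
split.
  by apply: (smooth_form_invariant TE Ck_rank1) => k z i j; exact: rank1_act.
move=> c z /dom_Cn0 z0; split.
  by apply/matrixP => i j; rewrite [RHS]mxE [X in Num.conj X]mxE !TE// rank1_adj.
move=> v; rewrite quad_formE.
under eq_bigr do under eq_bigr do rewrite TE//.
by rewrite quad_rank1 divr_ge0// exprn_ge0// ltW// rsq_gt0.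
Qed.

Lemma hopf_flow_metric (t : R) : 0 <= t -> 0 < 1 - n%:R * t ->
  hermitian_metric (hopf_flow halpha t).
Proof.
move=> t0 a0; have oU := @open_Cn0 R n.
have gE (c : chart M) z i j := @hopf_flowE t c z i j.
split.
  apply: (smooth_form_invariant gE).
    move=> i j k; apply: (CkD oU (Ck_conformal i j k)).
    exact: (CkM oU (Ck_cst oU k _) (Ck_drift i j k)).
  move=> k z i j z0; rewrite {1}(conformal_act k i j z0) {1}(drift_act k i j z0).
  move: (conformal _ _ _) (drift _ _ _) => p q; ring.
have GE (c : chart M) z i j : z != 0 -> hopf_flow halpha t c z i j =
    (1 - n%:R * t)%:C * conformal i j z + (n%:R * t)%:C * rank1 i j z.
  move=> z0; rewrite gE// /drift rmorphB !rmorphM /= rmorph_nat rmorph1.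
  move: (conformal _ _ _) (rank1 _ _ _) => p q; ring.
move=> c z /dom_Cn0 z0; split.
  apply/matrixP => i j; rewrite [RHS]mxE [X in Num.conj X]mxE !GE//.
  rewrite -(conformal_adj i j) -(rank1_adj i j).
  have H (a b : R) (p q : C) :
      a%:C * Num.conj p + b%:C * Num.conj q = Num.conj (a%:C * p + b%:C * q).
    rewrite rmorphD !rmorphM /=.
    by congr (_ * _ + _ * _); apply/esym/conj_Creal; rewrite complex_real.
  exact: H.
move=> v v0; rewrite quad_formE.
have -> : \sum_i \sum_j v 0 i * hopf_flow halpha t c z i j * Num.conj (v 0 j) =
    (1 - n%:R * t)%:C * (rsq v / rsq z) +
    (n%:R * t)%:C * (`|\sum_i v 0 i * Num.conj (z 0 i)| ^+ 2 / rsq z ^+ 2).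
  rewrite -quad_conformal -quad_rank1 !mulr_sumr -big_split /=.
  apply: eq_bigr => i _; rewrite !mulr_sumr -big_split /=; apply: eq_bigr => j _.
  by rewrite GE//; move: (conformal _ _ _) (rank1 _ _ _) => p q; ring.
rewrite ltr_wpDr//.
  apply: mulr_ge0; first by rewrite ler0c mulr_ge0.
  by rewrite divr_ge0// exprn_ge0// ltW// rsq_gt0.
by rewrite mulr_gt0 ?divr_gt0 ?rsq_gt0// ltcR.
Qed.

Section AffineInTime.
Variables (I : set R) (U : set Cn).
Hypotheses (oU : open U)
  (properI : forall t, I t -> ProperFilter (within [set h | I (t + h)] (0 : R)^')).

(** A class of functions that contains the coefficients of omega(t) and is stable
    under all the derivations of [st_smooth_on]. *)
Definition affine_in_time (F : R -> Cn -> C) : Prop :=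
  exists A B : Cn -> C, [/\ forall k, Ck U k A, forall k, Ck U k B &
    forall t z, I t -> U z -> F t z = A z + t%:C * B z].

Lemma affine_has_rder (A B : Cn -> C) F t z :
  (forall t z, I t -> U z -> F t z = A z + t%:C * B z) -> I t -> U z ->
  has_rder I (F ^~ z) t (B z).
Proof.
move=> FE It Uz.
have H := has_rderD (has_rder_cst I (A z) t)
  (has_rderM (has_rder_id I t) (has_rder_cst I (B z) t)).
refine (has_rder_ext _ _ (has_rder_eqd _ H)).
- by apply: near_within; near=> h => Ith _; rewrite FE.
- by rewrite FE.
- by rewrite mul1r mulr0 addr0 add0r.
Unshelve. all: by end_near. Qed.

Lemma dirder_affine (A B f : Cn -> C) (c : C) v z : Ck U 1 A -> Ck U 1 B ->
  (forall w, U w -> f w = A w + c * B w) -> U z ->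
  has_dirder v f z (dirder v A z + c * dirder v B z).
Proof.
move=> CA CB fE Uz.
have H := has_dirderD (Ck_dirder (v := v) CA Uz)
  (has_dirderZ (c := c) (Ck_dirder (v := v) CB Uz)).
apply: (has_dirder_near _ H).
by apply: (near_open oU (P := fun w => A w + c * B w = f w)) => // w Uw; rewrite fE.
Qed.

Lemma affine_stder d F : affine_in_time F -> affine_in_time (stder I d F).
Proof.
move=> [A [B [CA CB FE]]]; case: d => [v|] /=; last first.
  exists B, (fun=> 0); split=> //; first by move=> k; exact: Ck_cst.
  move=> t z It Uz; rewrite mulr0 addr0.
  by apply: (rderiveE (properI It)); exact: affine_has_rder FE It Uz.
exists (dirder v A), (dirder v B); split.
- by move=> k; exact: Ck_dirder_Ck.
- by move=> k; exact: Ck_dirder_Ck.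
- move=> t z It Uz; apply: dirderE.
  by apply: (dirder_affine (v := v) (CA 1%N) (CB 1%N) _ Uz) => w Uw; exact: FE.
Qed.

Lemma affine_st_smooth F : affine_in_time F -> st_smooth_on I U F.
Proof.
move=> aF ds; have {aF} : affine_in_time (iter_stder I ds F).
  by elim: ds => //= d ds IH; exact: affine_stder.
move: (iter_stder I ds F) => {ds}F [A [B [CA CB FE]]]; split.
- apply/subspace_continuousP => -[t z] [/= It Uz].
  suff H : (fun p : R * Cn => F p.1 p.2) @ within (I `*` U) (nbhs (t, z)) --> F t z.
    exact: H.
  rewrite (FE t z It Uz).
  have cfst : (fun p : R * Cn => p.1%:C : C) @ within (I `*` U) (nbhs (t, z)) --> t%:C.
    apply: (@cvg_comp _ _ _ fst (fun x : R => x%:C) _ (nbhs t)).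
      by apply: cvg_trans (@cvg_fst _ _ (nbhs t) (nbhs z) _); apply: cvg_fmap2; exact: cvg_within.
    exact: continuous_real_complex.
  have csnd (D : Cn -> C) : Ck U 0 D ->
      (fun p : R * Cn => D p.2) @ within (I `*` U) (nbhs (t, z)) --> D z.
    move=> CD; apply: (@cvg_comp _ _ _ snd D _ (nbhs z)); last exact: (Ck_cont CD Uz).
    by apply: cvg_trans (@cvg_snd _ _ (nbhs t) (nbhs z) _); apply: cvg_fmap2; exact: cvg_within.
  apply: (cvgC_ext _ (cvgC_D (csnd _ (CA 0%N)) (cvgC_M cfst (csnd _ (CB 0%N))))).
  near=> p; have [Ip Up] : (I `*` U) p by near: p; exact: withinT.
  by rewrite FE.
- by move=> t z It Uz; apply: has_rder_derivable (affine_has_rder FE It Uz).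
- move=> v t z It Uz.
  apply: has_rder_derivable (dirder_affine (v := v) (CA 1%N) (CB 1%N) _ Uz) => w Uw.
  exact: FE.
Unshelve. all: by end_near. Qed.

Lemma iter_dirder_affine (A B f : Cn -> C) (c : C) vs :
  (forall k, Ck U k A) -> (forall k, Ck U k B) ->
  (forall w, U w -> f w = A w + c * B w) ->
  forall z, U z -> iter_dirder vs f z = iter_dirder vs A z + c * iter_dirder vs B z.
Proof.
move=> CA CB fE; have CI (D : Cn -> C) : (forall k, Ck U k D) ->
    forall ws k, Ck U k (iter_dirder ws D).
  by move=> CD; elim=> //= w ws IH k; exact: Ck_dirder_Ck.
elim: vs => //= v vs IH z Uz; apply: dirderE.
by apply: (dirder_affine (v := v) (CI _ CA vs 1%N) (CI _ CB vs 1%N) IH Uz).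
Qed.

End AffineInTime.

End HopfFlow.

Arguments Ck_conformal {R n} i j k.
Arguments Ck_rank1 {R n} i j k.
Arguments Ck_drift {R n} i j k.

(** * The explicit solution and its limit *)

Section TimeInterval.
Variable R : realType.

Lemma time_intervalP (T : \bar R) (t : R) : time_interval T t ->
  exists2 e : R, 0 < e & forall h, 0 <= h -> h < e -> time_interval T (t + h).
Proof.
move=> [t0]; case: T => [T| |] /=.
- rewrite lte_fin => tT; exists (T - t); first by rewrite subr_gt0.
  by move=> h h0 hT; split; [exact: addr_ge0|rewrite lte_fin addrC -ltrBrDr].
- move=> _; exists 1 => // h h0 _; split; [exact: addr_ge0|exact: ltry].
- by rewrite ltNge leNye.
Qed.

(** Every time of a nonempty interval [0, T) has admissible positive increments. *)
Lemma time_proper (T : \bar R) (t : R) : time_interval T t ->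
  ProperFilter (within [set h | time_interval T (t + h)] (0 : R)^').
Proof.
move=> It; have [e e0 He] := time_intervalP It.
apply: Build_ProperFilter_ex => P WP.
have {}WP : \forall h \near (0 : R), h != 0 -> time_interval T (t + h) -> P h by exact: WP.
have /nbhs_ballP[d /= d0 dP] := WP.
pose h := Num.min d e / 2.
have h0 : 0 < h by rewrite divr_gt0// lt_min d0.
have : h < Num.min d e by rewrite /h ltr_pdivrMr// ltr_pMr ?ltr1n// lt_min d0.
rewrite lt_min => /andP[hd he]; exists h; apply: dP.
- by rewrite /ball/= sub0r normrN gtr0_norm.
- by rewrite gt_eqF.
- by apply: He => //; exact: ltW.
Qed.

(** At positive times the derivative relative to [0, T) is two-sided. *)
Lemma time_interior (T : \bar R) (t : R) : time_interval T t -> 0 < t ->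
  within [set h | time_interval T (t + h)] (0 : R)^' = (0 : R)^'.
Proof.
move=> It t0; have [e e0 He] := time_intervalP It; have [_ tT] := It.
have nI : \forall h \near (0 : R)^', time_interval T (t + h).
  near=> h; have [h0|h0] := leP 0 h.
    apply: He => //; apply: le_lt_trans (ler_norm h) _.
    by near: h; exact: dnbhs0_lt.
  split.
    rewrite -lerBlDl sub0r -(opprK h) lerN2 -(ltr0_norm h0).
    by apply: ltW; near: h; exact: dnbhs0_lt.
  by apply: le_lt_trans tT; rewrite lee_fin gerDl ltW.
apply/seteqP; split=> A.
  by move=> WA; apply: filterS2 nI WA => h Ih; exact.
exact: cvg_within.
Unshelve. all: by end_near. Qed.

End TimeInterval.

Section HopfSolution.
Variables (R : realType) (n : nat) (alpha : 'rV[R[i]]_n).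
Hypothesis halpha : hopf_param alpha.
Hypothesis n0 : (0 < n)%N.
Local Notation C := R[i].
Local Notation Cn := 'rV[R[i]]_n.
Local Notation Re := (@complex.Re R).
Local Notation Im := (@complex.Im R).
Local Notation M := (hopf_manifold halpha).
Local Notation U0 := (@Cn0 R n).
Local Notation T := (n%:R^-1 : R).

Lemma dom_subset_Cn0 (c : chart M) : dom c `<=` U0.
Proof. by move=> z /dom_Cn0. Qed.

Lemma hopf_flow_solution : chern_ricci_flow (omegaH halpha) T%:E (hopf_flow halpha).
Proof.
have nR : 0 < (n%:R : R) by rewrite ltr0n.
have It_pos t : time_interval T%:E t -> 0 <= t /\ 0 < 1 - n%:R * t.
  move=> [t0]; rewrite lte_fin => tT; split=> //.
  by rewrite subr_gt0 mulrC -ltr_pdivlMr// div1r.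
split.
- by move=> t /It_pos[t0 a0]; exact: hopf_flow_metric.
- move=> c i j; have oc := @dom_open _ _ M c.
  apply: (affine_st_smooth oc); first by move=> t; exact: time_proper.
  exists (conformal i j), (drift i j); split.
  + by move=> k; exact: (Ck_sub (@dom_subset_Cn0 c) (Ck_conformal i j k)).
  + by move=> k; exact: (Ck_sub (@dom_subset_Cn0 c) (Ck_drift i j k)).
  + by move=> t z _ /dom_Cn0; exact: hopf_flowE.
- move=> t c z i j It cz; have z0 := dom_Cn0 cz; have [t0 a0] := It_pos t It.
  rewrite chern_ricci_hopf_flow// opprK; apply: (rderiveE (time_proper It)).
  apply: (@affine_has_rder R n (time_interval T%:E) (dom c) (conformal i j) (drift i j)
    (fun s w => hopf_flow halpha s c w i j)) => // s w _ /dom_Cn0.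
  exact: hopf_flowE.
- move=> c z /dom_Cn0 z0; apply/matrixP => i j.
  by rewrite hopf_flowE// rmorph0 mul0r addr0 mxE.
Qed.

Lemma hopf_flow_cvg : smooth_cvg_left (hopf_flow halpha) T (omegaT halpha).
Proof.
have nC : (n%:R : C) != 0 by rewrite pnatr_eq0 -lt0n.
move=> c i j vs K e cK Kc e0; have oc := @dom_open _ _ M c.
have CA k : Ck (dom c) k (conformal i j).
  by exact: (Ck_sub (@dom_subset_Cn0 c) (Ck_conformal i j k)).
have CB k : Ck (dom c) k (drift i j).
  by exact: (Ck_sub (@dom_subset_Cn0 c) (Ck_drift i j k)).
have TE w : dom c w -> omegaT halpha c w i j = conformal i j w + T%:C * drift i j w.
  move=> /dom_Cn0 w0; rewrite /drift mxE -/(rank1 i j w).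
  have -> : T%:C = n%:R^-1 by rewrite fmorphV rmorph_nat.
  by rewrite mulrA mulVf// mul1r addrC subrK.
have E t z : K z -> iter_dirder vs (fun w => hopf_flow halpha t c w i j) z -
    iter_dirder vs (fun w => omegaT halpha c w i j) z =
    (t - T)%:C * iter_dirder vs (drift i j) z.
  move=> /Kc cz; rewrite (iter_dirder_affine oc vs CA CB TE cz).
  rewrite (iter_dirder_affine (c := t%:C) oc vs CA CB _ cz); last first.
    by move=> w /dom_Cn0; exact: hopf_flowE.
  move: (iter_dirder vs (conformal i j) z) (iter_dirder vs (drift i j) z) => p q.
  by rewrite rmorphB /=; ring.
pose b z := Re `|iter_dirder vs (drift i j) z|.
have [B B0 bB] : exists2 B, 0 < B & forall z, K z -> b z < B.
  have [->|/set0P K0] := eqVneq K set0; first by exists 1.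
  have cb : {within K, continuous b}.
    apply: (continuous_subspaceW Kc).
    rewrite continuous_open_subspace// => z /set_mem cz.
    apply: (@cvg_comp _ _ _ (iter_dirder vs (drift i j)) (fun y : C => Re `|y|)
      _ (nbhs (iter_dirder vs (drift i j) z))).
      have Cvs : Ck (dom c) 0 (iter_dirder vs (drift i j)).
        have : forall ws k, Ck (dom c) k (iter_dirder ws (drift i j)).
          by elim=> [k|w ws IH k]; [exact: CB|exact: Ck_dirder_Ck (IH k.+1)].
        exact.
      exact: (Ck_cont Cvs cz).
    exact: continuous_norm.
  have [p _ pmax] := compact_EVT_max K0 cK cb.
  exists (Num.max 0 (b p) + 1); first by rewrite ltr_wpDl// le_max lexx.
  move=> z Kz; rewrite (le_lt_trans (pmax z (mem_set Kz)))//.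
  by rewrite (@le_lt_trans _ _ (Num.max 0 (b p)))// ?ltrDl// le_max lexx orbT.
near=> t => z Kz; rewrite E// normrM norm_real_complex.
rewrite -[X in _ * X]RRe_real ?normr_real// -rmorphM /= ltcR -/(b z).
apply: (@le_lt_trans _ _ (`|t - T| * B)).
  by rewrite ler_wpM2l// ltW// bB.
rewrite -ltr_pdivlMr// distrC.
have : T - e / B < t by near: t; apply: nbhs_left_gt; rewrite ltrBlDr ltrDl divr_gt0.
have : t < T by near: t; exact: nbhs_left_lt.
move=> tT; rewrite ltrBlDr -ltrBlDl => H.
by rewrite ger0_norm ?subr_ge0 ?ltW.
Unshelve. all: by end_near. Qed.

End HopfSolution.

(** * Compact shells, null vectors and orbits *)

Section Shells.
Variables (R : realType) (n : nat).
Local Notation C := R[i].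
Local Notation Cn := 'rV[R[i]]_n.
Local Notation Re := (@complex.Re R).
Local Notation Im := (@complex.Im R).

(** A shell is bounded by Euclidean spheres; the radii are squared. *)
Definition shell (a b : R) : set Cn := [set z | a <= Re (rsq z) <= b].

Lemma continuous_Re_rsq : continuous (fun z : Cn => Re (rsq z)).
Proof.
move=> z; apply: (@cvg_comp _ _ _ (@rsq R n) Re _ (nbhs (rsq z))).
  exact: (Ck_cont (Ck_rsq 0 openT)).
exact: continuous_Re.
Qed.

(** For b >= 1, |z_i|^2 <= b implies |z_i| <= b; the crude bound is enough. *)
Lemma norm_coord_le (z : Cn) (b : R) i : 1 <= b -> Re (rsq z) <= b ->
  Re `|z 0 i| <= b.
Proof.
move=> b1 zb; have [x0 x1] : 0 <= Re `|z 0 i| /\ (Re `|z 0 i|) ^+ 2 <= Re (rsq z).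
  have xE : `|z 0 i| = (Re `|z 0 i|)%:C by rewrite RRe_real ?normr_real.
  split; first by have := normr_ge0 (z 0 i); rewrite xE ler0c.
  rewrite -lecR rmorphXn /= -xE RRe_real; last first.
    by apply: rpred_sum => j _; rewrite rpredX// normr_real.
  by rewrite /rsq (bigD1 i)//= lerDl sumr_ge0// => j _; rewrite exprn_ge0.
rewrite -(@ler_pXn2r _ 2) ?nnegrE//; last by rewrite (le_trans _ b1).
by rewrite (le_trans x1)// (le_trans zb)// ler_eXnr// (le_trans _ b1).
Qed.

Lemma compact_shell (a b : R) : 1 <= b -> compact (shell a b).
Proof.
move=> b1; pose D : set Cn := [set z | forall i, Re `|z ord0 i| <= b].
have cD : compact D.
  exact: (@rV_compact _ n (fun _ => [set y : C | Re `|y| <= b]) (fun _ => @compact_disc R b)).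
apply: (subclosed_compact _ cD) => [|z /andP[_ zb] i]; last exact: norm_coord_le.
rewrite (_ : shell a b = [set z | a <= Re (rsq z)] `&` [set z | Re (rsq z) <= b]); last first.
  by apply/seteqP; split => z; rewrite /shell /= => /andP.
apply: closedI.
  apply: (@closed_comp _ _ (fun z : Cn => Re (rsq z)) [set x | a <= x]) => [z _|].
    exact: continuous_Re_rsq.
  exact: closed_ge.
apply: (@closed_comp _ _ (fun z : Cn => Re (rsq z)) [set x | x <= b]) => [z _|].
  exact: continuous_Re_rsq.
exact: closed_le.
Qed.

Lemma shell_neq0 (a b : R) (z : Cn) : 0 < a -> shell a b z -> z != 0.
Proof.
move=> a0 /andP[az _]; apply: contraTneq az => ->; rewrite -ltNge.
rewrite /rsq big1 // => i _; by rewrite mxE normr0 expr0n.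
Qed.

(** The orthogonal complement of p has dimension at least n - 1 >= 1. *)
Lemma null_vector (p : Cn) : (2 <= n)%N ->
  exists2 v : Cn, v != 0 & \sum_i v 0 i * Num.conj (p 0 i) = 0.
Proof.
move=> n2; have : kermx (adjmx p) != 0.
  rewrite -mxrank_eq0 mxrank_ker subn_eq0 -ltnNge.
  by rewrite (leq_ltn_trans (rank_leq_col _)).
move=> /rowV0Pn[v /sub_kermxP vp v0]; exists v => //.
transitivity ((v *m adjmx p) 0 0); last by rewrite vp mxE.
by rewrite mxE; apply: eq_bigr => i _; rewrite !mxE.
Qed.

Lemma rsqZ (a : R) (v : Cn) : rsq (a%:C *: v) = (a ^+ 2)%:C * rsq v.
Proof.
rewrite /rsq mulr_sumr; apply: eq_bigr => i _; rewrite mxE normrM exprMn.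
by rewrite norm_real_complex -rmorphXn /= real_normK ?num_real.
Qed.

Lemma null_unit_vector (p : Cn) : (2 <= n)%N ->
  exists2 v : Cn, shell 1 1 v & \sum_i v 0 i * Num.conj (p 0 i) = 0.
Proof.
move=> /(null_vector p)[v v0 vp].
have [rE r0] := gt0_complex_real (rsq_gt0 v0).
exists ((Num.sqrt (Re (rsq v)))^-1%:C *: v); last first.
  under eq_bigr do rewrite mxE -mulrA.
  by rewrite -mulr_sumr vp mulr0.
rewrite /shell /= rsqZ rE -rmorphM /= exprVn (sqr_sqrtr (ltW r0)).
by rewrite mulVf ?lexx// gt_eqF.
Qed.

End Shells.

Section Orbits.
Variables (R : realType) (n : nat) (alpha : 'rV[R[i]]_n).
Hypothesis halpha : hopf_param alpha.
Local Notation C := R[i].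
Local Notation Cn := 'rV[R[i]]_n.
Local Notation Re := (@complex.Re R).

Lemma expR_int (y : R) (k : int) : expR y ^ k = expR (k%:~R * y).
Proof.
case: k => k; first by rewrite -exprnP -expRM_natl.
by rewrite NegzE rmorphN /= mulNr expRN -exprnN; congr (_^-1); rewrite -expRM_natl.
Qed.

(** The multiplicative group generated by l <> 1 is discrete and cocompact in the
    positive reals; the exponent is an integer part of a ratio of logarithms. *)
Lemma pow_fundamental (l : R) : 0 < l -> l != 1 -> exists2 b : R, 1 <= b &
  forall r : R, 0 < r -> exists k : int, 1 <= l ^ k * r <= b.
Proof.
(* the case l < 1 follows by inverting l *)
have gt1 (m : R) : 1 < m -> forall r : R, 0 < r -> exists k : int, 1 <= m ^ k * r <= m.
  move=> m1 r r0; have m0 : 0 < m by rewrite (lt_trans _ m1).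
  have [y mE] : exists y, m = expR y by exists (ln m); rewrite lnK.
  have [x rE] : exists x, r = expR x by exists (ln r); rewrite lnK.
  have y0 : 0 < y by rewrite -expR_gt1 -mE.
  exists (- Num.floor (x / y)); rewrite mE rE expR_int -expRD.
  rewrite -[X in X <= _]expR0 !ler_expR.
  rewrite rmorphN /= mulNr addrC subr_ge0 -ler_pdivlMr//.
  have /andP[-> /ltW] := floor_itv (x / y).
  by rewrite rmorphD /= ler_pdivrMr// mulrDl mul1r lerBlDl.
move=> l0 l1; have [l2|l2] := ltP 1 l; first by exists l; [exact: ltW|exact: gt1].
have l3 : 1 < l^-1 by rewrite invf_gt1// lt_neqAle l1.
exists l^-1; first exact: ltW.
by move=> r /(gt1 _ l3)[k]; exists (- k); rewrite -exprz_inv.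
Qed.

Lemma alpha_modulus : exists l : R, [/\ 0 < l, l != 1 &
  forall (k : int) (z : Cn), rsq (alpha_act alpha k z) = (l ^ k)%:C * rsq z].
Proof.
have [i0 _] := alpha_index halpha; have [_ eqa na] := halpha.
have a0 : 0 < `|alpha 0 i0| by rewrite normr_gt0 alpha_neq0.
have [aE l0] := gt0_complex_real a0; set l := Re _ in aE l0.
exists (l ^+ 2); split; first by rewrite exprn_gt0.
  have := na i0; rewrite aE; apply: contraNneq => l1.
  by have /eqP := l1; rewrite sqrp_eq1 ?ltW// => /eqP ->.
move=> k z; apply: rsq_alpha_act => i.
rewrite -normCK (_ : (l ^+ 2) ^ k = (l ^ k) ^+ 2); last by rewrite !exprnP exprzAC.
rewrite rmorphXn /= rmorphXz /=; last by rewrite unitfE gt_eqF.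
rewrite -aE -(eqa i i0).
by case: k => k; rewrite ?NegzE -?exprnN ?normfV ?exprnP -?exprnP normrX.
Qed.

(** The Hopf manifold is compact: it is the image of a compact shell. *)
Lemma fundamental_shell : exists2 b : R, 1 <= b &
  forall w : Cn, w != 0 -> exists k : int, shell 1 b (alpha_act alpha k w).
Proof.
have [l [l0 l1 lP]] := alpha_modulus; have [b b1 bP] := pow_fundamental l0 l1.
exists b => // w /rsq_gt0/gt0_complex_real[rE r0]; have [k kP] := bP _ r0.
by exists k; rewrite /shell /= lP rE -rmorphM.
Qed.

Lemma alpha_act_neq0 k (z : Cn) : z != 0 -> alpha_act alpha k z != 0.
Proof.
apply: contraNneq => z0; rewrite -(alpha_act0 alpha z) -(addNr k).
rewrite -(alpha_actD halpha) z0; apply/eqP/rowP => i.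
by rewrite !mxE mulr0.
Qed.

End Orbits.

Section LinearOperators.
Variables (R : realType) (n : nat).
Local Notation C := R[i].
Local Notation Cn := 'rV[R[i]]_n.

Lemma Ck_local (U : set Cn) k f :
  (forall z, U z -> exists V, [/\ open V, V z & Ck V k f]) -> Ck U k f.
Proof.
elim: k f => [|k IH] f H.
  by apply: Ck0 => z /H[V [oV Vz Cf]]; exact: Ck_cont Cf Vz.
apply: Ck_succ.
- by move=> z /H[V [oV Vz Cf]]; exact: Ck_cont Cf Vz.
- by move=> v z /H[V [oV Vz Cf]]; exists (dirder v f z); exact: Ck_dirder Cf Vz.
- move=> v; apply: IH => z /H[V [oV Vz Cf]]; exists V; split=> //.
  exact: Ck_dirder_Ck.
Qed.

Variable U : set Cn.
Hypothesis oU : open U.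
Variables (J : Type) (r : seq J) (c : J -> C) (F : J -> Cn -> C).

Lemma dz_lincomb (i : 'I_n) z : (forall j, Ck U 1 (F j)) -> U z ->
  dz i (fun w => \sum_(j <- r) c j * F j w) z = \sum_(j <- r) c j * dz i (F j) z.
Proof.
move=> CF Uz; rewrite /dz !(dirder_lincomb r c _ CF Uz) mulr_sumr -sumrB mulr_suml.
apply: eq_bigr => j _.
by move: (dirder (ebase R i) (F j) z) (dirder ('i%C *: ebase R i) (F j) z) => p q; ring.
Qed.

Lemma dzbar_lincomb (i : 'I_n) z : (forall j, Ck U 1 (F j)) -> U z ->
  dzbar i (fun w => \sum_(j <- r) c j * F j w) z = \sum_(j <- r) c j * dzbar i (F j) z.
Proof.
move=> CF Uz; rewrite /dzbar !(dirder_lincomb r c _ CF Uz) mulr_sumr -big_split mulr_suml.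
apply: eq_bigr => j _ /=.
by move: (dirder (ebase R i) (F j) z) (dirder ('i%C *: ebase R i) (F j) z) => p q; ring.
Qed.

End LinearOperators.

Section LeviLincomb.
Variables (R : realType) (n : nat).
Local Notation C := R[i].
Local Notation Cn := 'rV[R[i]]_n.
Variable U : set Cn.
Hypothesis oU : open U.
Variables (J : Type) (r : seq J) (c : J -> C) (F : J -> Cn -> C).

Lemma Ck_lincomb k : (forall j, Ck U k (F j)) ->
  Ck U k (fun w => \sum_(j <- r) c j * F j w).
Proof.
move=> CF; apply: (Ck_sum oU) => j _.
exact: (CkM oU (Ck_cst oU k (c j)) (CF j)).
Qed.

Lemma levi_lincomb (a b : 'I_n) z : (forall j, Ck U 2 (F j)) -> U z ->
  dz a (dzbar b (fun w => \sum_(j <- r) c j * F j w)) z =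
  \sum_(j <- r) c j * dz a (dzbar b (F j)) z.
Proof.
move=> CF Uz; have C1 j : Ck U 1 (dzbar b (F j)) by exact: (Ck_dzbar oU b (CF j)).
rewrite -(dz_lincomb r c a C1 Uz); apply: (eq_dz a oU _ _ Uz).
  by move=> w Uw; apply: (dzbar_lincomb r c b _ Uw) => j; exact: (Ck_pred oU (CF j)).
by apply: (Ck_dzbar oU); exact: Ck_lincomb.
Qed.

End LeviLincomb.

(** * The potential of an arbitrary solution *)

Section JointContinuity.
Variables (R : realType) (n : nat).
Local Notation C := R[i].
Local Notation Cn := 'rV[R[i]]_n.

(** Joint continuity relative to I x V, as a statement about neighbourhoods in
    the product. *)
Lemma joint_near (I : set R) (V : set Cn) (F : R -> Cn -> C) t z (e : R) :
  {within I `*` V, continuous (fun p : R * Cn => F p.1 p.2)} -> open V ->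
  I t -> V z -> 0 < e ->
  \forall p \near (t, z), I p.1 -> V p.2 /\ `|F t z - F p.1 p.2| < e%:C.
Proof.
move=> /subspace_continuousP cF oV It Vz e0.
have H : (fun p : R * Cn => F p.1 p.2) @ within (I `*` V) (nbhs (t, z)) --> F t z.
  exact: (cF (t, z) (conj It Vz)).
have /= He := (cvgCP _ _ _).1 H e e0.
have {}He : \forall p \near (t, z), (I `*` V) p -> `|F t z - F p.1 p.2| < e%:C by exact: He.
have nV : \forall p \near (t, z), V p.2.
  exact: (@cvg_snd _ _ (nbhs t) (nbhs z) _ V (open_nbhs_nbhs (conj oV Vz))).
by apply: filterS2 He nV => p Hp Vp Ip; split=> //; exact: Hp.
Qed.

Lemma eq_levi (U : set Cn) (i j : 'I_n) f h z : open U ->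
  (forall w, U w -> f w = h w) -> Ck U 2 f -> U z ->
  dz i (dzbar j f) z = dz i (dzbar j h) z.
Proof.
move=> oU fh Cf Uz; apply: (eq_dz i oU _ _ Uz); last exact: (Ck_dzbar oU).
by move=> w Uw; apply: (eq_dzbar j oU fh (Ck_pred oU Cf)).
Qed.

End JointContinuity.

Section MaximalTime.
Variables (R : realType) (n : nat) (alpha : 'rV[R[i]]_n).
Hypothesis halpha : hopf_param alpha.
Local Notation C := R[i].
Local Notation Cn := 'rV[R[i]]_n.
Local Notation Re := (@complex.Re R).
Local Notation Im := (@complex.Im R).
Local Notation M := (hopf_manifold halpha).
Local Notation U0 := (@Cn0 R n).
Local Notation oU := (@open_Cn0 R n).
Variables (T' : \bar R) (g : R -> coefs M).
Hypothesis flow_g : chern_ricci_flow (omegaH halpha) T' g.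
Local Notation I := (time_interval T').

(** The coefficients in any chart around z; they do not depend on the chart. *)
Definition flow_mx (t : R) (z : Cn) : 'M[C]_n :=
  xget 0 [set A | exists2 c : chart M, dom c z & A = g t c z].

Lemma chart_ex (z : Cn) : z != 0 -> exists c : chart M, dom c z.
Proof.
move=> z0; have [e e0 [h1 h2]] := hopf_injective_ball halpha z0.
exists (exist _ (ball z e) (And3 (ball_open _ _) h1 h2)).
exact: ballxx.
Qed.

Lemma flow_form11 (t : R) (c d : chart M) (z : Cn) (k : int) i j : I t ->
  dom c z -> dom d (alpha_act alpha k z) ->
  g t c z i j = alpha 0 i ^ k * g t d (alpha_act alpha k z) i j * Num.conj (alpha 0 j ^ k).
Proof.
move=> It cz dz; have [met _ _ _] := flow_g; have [[gf _] _] := met t It.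
exact: (form11P (g t)).1 gf c d z k cz dz i j.
Qed.

Lemma flow_mxE (t : R) (c : chart M) (z : Cn) : I t -> dom c z -> flow_mx t z = g t c z.
Proof.
move=> It cz; rewrite /flow_mx; case: xgetP => [A _ [d dz ->]|/(_ (g t c z))]; last first.
  by case; exists c.
apply/matrixP => i j; have := @flow_form11 t d c z 0 i j It dz.
by rewrite alpha_act0 !expr0z rmorph1 mul1r mulr1; exact.
Qed.

Lemma Ck_flow (t : R) i j k : I t -> Ck U0 k (fun z => flow_mx t z i j).
Proof.
move=> It; apply: Ck_local => z z0; have [c cz] := chart_ex z0.
have oc := @dom_open _ _ M c; exists (dom c); split=> //.
have [met _ _ _] := flow_g; have [[_ gs] _] := met t It.
apply: (Ck_eq oc (f := fun w => g t c w i j)).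
  by move=> w cw; rewrite (flow_mxE It cw).
by have /(smooth_onP oc) := gs c i j; exact.
Qed.

Lemma flow_act (t : R) (k : int) (z : Cn) i j : I t -> z != 0 ->
  flow_mx t z i j =
  alpha 0 i ^ k * flow_mx t (alpha_act alpha k z) i j * Num.conj (alpha 0 j ^ k).
Proof.
move=> It z0; have [c cz] := chart_ex z0.
have [d dz] := chart_ex (alpha_act_neq0 halpha k z0).
by rewrite (flow_mxE It cz) (flow_mxE It dz); exact: flow_form11.
Qed.

Lemma flow_posdef (t : R) (z : Cn) : I t -> z != 0 -> posdefmx (flow_mx t z).
Proof.
move=> It z0; have [c cz] := chart_ex z0; rewrite (flow_mxE It cz).
by have [met _ _ _] := flow_g; have [_ +] := met t It; exact.
Qed.

(** det g(t) / det omega_H, which is invariant under the deck group while neither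
    determinant is. *)
Definition vol_ratio (t : R) (z : Cn) : C := \det (flow_mx t z) * rsq z ^+ n.

Lemma vol_ratio_gt0 (t : R) (z : Cn) : I t -> z != 0 -> 0 < vol_ratio t z.
Proof.
move=> It z0; rewrite mulr_gt0 ?exprn_gt0 ?rsq_gt0//.
exact: posdef_det_gt0 (flow_posdef It z0).
Qed.

Lemma vol_ratio_act (t : R) (k : int) (z : Cn) : I t -> z != 0 ->
  vol_ratio t (alpha_act alpha k z) = vol_ratio t z.
Proof.
move=> It z0; have [rho rho0 rhoE] := alpha_pow_norm halpha k.
rewrite /vol_ratio (rsq_alpha_act z rhoE).
have -> : flow_mx t z = diag_mx (\row_i alpha 0 i ^ k) *m
    flow_mx t (alpha_act alpha k z) *m diag_mx (\row_i Num.conj (alpha 0 i ^ k)).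
  apply/matrixP => i j; rewrite mul_diag_mx mul_mx_diag [RHS]mxE [X in _ = X * _]mxE !mxE.
  exact: flow_act.
rewrite !det_mulmx !det_diag exprMn.
have -> : rho ^+ n = (\prod_i (\row_i alpha 0 i ^ k) 0 i) *
    \prod_i (\row_i Num.conj (alpha 0 i ^ k)) 0 i.
  rewrite -big_split /= -[in LHS](card_ord n) -prodr_const; apply: eq_bigr => i _.
  by rewrite !mxE rhoE.
by ring.
Qed.

Lemma Ck_vol_ratio (t : R) k : I t -> Ck U0 k (vol_ratio t).
Proof.
move=> It; apply: (CkM oU).
  by apply: (Ck_det oU) => i j; exact: Ck_flow.
have Cr := Ck_rsq k oU.
apply: (Ck_eq oU (f := fun z => \prod_(l < n) rsq z)).
  by move=> z _; rewrite prodr_const card_ord.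
by apply: (Ck_prod oU) => l _.
Qed.

Definition potential (t : R) (z : Cn) : C := (ln (Re (vol_ratio t z)))%:C.

Lemma Ck_potential (t : R) k : I t -> Ck U0 k (potential t).
Proof.
move=> It; apply: (Ck_ln oU); last exact: Ck_vol_ratio.
by move=> z; exact: vol_ratio_gt0.
Qed.

Lemma potential_act (t : R) (k : int) (z : Cn) : I t -> z != 0 ->
  potential t (alpha_act alpha k z) = potential t z.
Proof. by move=> It z0; rewrite /potential vol_ratio_act. Qed.

Lemma ln_det_flow (t : R) (c : chart M) (w : Cn) : I t -> dom c w ->
  (ln (Re (\det (g t c w))))%:C = potential t w - n%:R * ln_rsq w.
Proof.
move=> It cw; have w0 := dom_Cn0 cw.
have d0 := posdef_det_gt0 (flow_posdef It w0).
have [dE dr] := gt0_complex_real d0; have [rE r0] := gt0_complex_real (rsq_gt0 w0).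
rewrite -(flow_mxE It cw) /potential /vol_ratio dE Re_rM rE -rmorphXn /=.
rewrite lnM ?posrE ?exprn_gt0// lnXn// rmorphD rmorphMn /= mulr_natl.
by rewrite /ln_rsq addrK.
Qed.

(** d g_ij / dt in terms of the invariant potential. *)
Definition velocity (t : R) (i j : 'I_n) (z : Cn) : C :=
  dz i (dzbar j (potential t)) z + drift i j z.

(** The flow equation: log det g = u - n log r^2, and the complex Hessian of the
    last term is the drift. *)
Lemma velocityE (t : R) (c : chart M) (z : Cn) i j : I t -> dom c z ->
  rderive I (fun s => g s c z i j) t = velocity t i j z.
Proof.
move=> It cz; have [_ _ flow _] := flow_g; rewrite (flow t c z i j It cz).
have z0 := dom_Cn0 cz; have oc := @dom_open _ _ M c.
rewrite mxE opprK.
(* log det g as a linear combination, indexed by the booleans *)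
pose F (b : bool) : Cn -> C := if b then potential t else @ln_rsq R n.
pose a (b : bool) : C := if b then 1 else - n%:R.
have CF b : Ck U0 2 (F b) by case: b; [exact: Ck_potential|exact: Ck_ln_rsq].
have E w : dom c w -> \sum_(b <- [:: true; false]) a b * F b w =
    (ln (Re (\det (g t c w))))%:C.
  move=> cw; rewrite (ln_det_flow It cw) !big_cons big_nil addr0 /a /F.
  by rewrite mul1r mulNr.
rewrite -(eq_levi i j oc E); last exact: cz; last first.
  exact: (Ck_sub (@dom_subset_Cn0 _ _ _ halpha c) (Ck_lincomb oU _ a CF)).
rewrite [LHS](levi_lincomb oU [:: true; false] a i j CF z0).
have S (x : bool -> C) : \sum_(b <- [:: true; false]) x b = x true + x false.
  by rewrite !big_cons big_nil addr0.
rewrite [LHS]S /a /F.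
rewrite (levi_ln_rsq i j z0) /velocity /drift mul1r /conformal.
by congr (_ + _); rewrite mulNr -mulrN opprB.
Qed.

Lemma velocity_near (t : R) (z : Cn) i j (e : R) : I t -> z != 0 -> 0 < e ->
  \forall p \near (t, z), I p.1 ->
    p.2 != 0 /\ `|velocity t i j z - velocity p.1 i j p.2| < e%:C.
Proof.
move=> It z0 e0; have [c cz] := chart_ex z0; have oc := @dom_open _ _ M c.
have [_ sm _ _] := flow_g; have [cont _ _] := sm c i j [:: None].
have H := joint_near cont oc It cz e0.
apply: filterS H => p H Ip; have [cp] := H Ip.
rewrite /= (velocityE i j It cz) (velocityE i j Ip cp); split=> //.
exact: dom_Cn0 cp.
Qed.

Lemma has_rder_flow (t : R) (z : Cn) i j : I t -> z != 0 ->
  has_rder I (fun s => flow_mx s z i j) t (velocity t i j z).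
Proof.
move=> It z0; have [c cz] := chart_ex z0; have [_ sm _ _] := flow_g.
have [_ dt _] := sm c i j [::].
have H : has_rder I (fun s => g s c z i j) t (velocity t i j z).
  by rewrite -(velocityE i j It cz); exact: rderivableP (dt t z It cz).
apply: (has_rder_ext _ _ H).
  by apply: near_within; near=> h => Ith _; rewrite (flow_mxE Ith cz).
by rewrite (flow_mxE It cz).
Unshelve. all: by end_near. Qed.

Lemma flow_time_continuous (z : Cn) i j (t : R) (e : R) : I t -> z != 0 -> 0 < e ->
  \forall s \near t, I s -> `|flow_mx t z i j - flow_mx s z i j| < e%:C.
Proof.
move=> It z0 e0; have [c cz] := chart_ex z0; have oc := @dom_open _ _ M c.
have [_ sm _ _] := flow_g; have [cont _ _] := sm c i j [::].
have H := joint_near cont oc It cz e0.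
case: H => -[A B] /= [At Bz] AB; apply: filterS At => s As Is.
have [_] := AB (s, z) (conj As (nbhs_singleton Bz)) Is => /=.
by rewrite (flow_mxE It cz) (flow_mxE Is cz).
Qed.

(** A Heine-type argument, by the covering characterization of the compactness of
    [0, a] x K. *)
Lemma velocity_unif (a : R) (K : set Cn) i j (e : R) : (a%:E < T')%E ->
  compact K -> K `<=` U0 -> 0 < e ->
  \forall d \near (0 : R), forall s t z, 0 <= s <= a -> 0 <= t <= a ->
    `|s - t| < d -> K z -> `|velocity s i j z - velocity t i j z| < e%:C.
Proof.
move=> aT cK KU e0.
have seg t : 0 <= t <= a -> I t.
  by move=> /andP[t0 ta]; split=> //; apply: le_lt_trans aT; rewrite lee_fin.
pose P (d : R) (p : R * Cn) := forall s, 0 <= s <= a -> `|s - p.1| < d ->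
  `|velocity s i j p.2 - velocity p.1 i j p.2| < e%:C.
have cS : compact (`[0, a]%classic `*` K).
  by apply: compact_setX => //; exact: segment_compact.
have /(compact_near_coveringP _).1/near_covering_withinP := cS.
have H : forall p, (`[0, a]%classic `*` K) p ->
    \forall p' \near p & d \near (0 : R), (`[0, a]%classic `*` K) p' -> P d p'.
  move=> [t z] [/= ta Kz]; rewrite in_itv /= in ta.
  have e2 : 0 < e / 2 by rewrite divr_gt0.
  have := velocity_near i j (seg t ta) (KU z Kz) e2.
  case=> -[A B] /= [At Bz] AB.
  have /nbhs_ballP[r /= r0 rA] := At.
  exists (ball t (r / 2) `*` B, ball 0 (r / 2)).
    split=> /=; last by apply: nbhsx_ballx; rewrite divr_gt0.
    by exists (ball t (r / 2), B) => //=; split=> //; apply: nbhsx_ballx; rewrite divr_gt0.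
  move=> [[t' z'] d] /= [[tt' Bz'] d0] [/= ta' Kz'] s sa std.
  rewrite in_itv /= in ta'.
  have ts : ball t r s.
    rewrite /ball/= in tt' d0 *; rewrite -(subrKA t') (le_lt_trans (ler_normD _ _))//.
    rewrite [ltRHS]splitr ltrD// distrC (lt_trans std)//.
    by rewrite (le_lt_trans _ d0)// sub0r normrN ler_norm.
  have At' : A t'.
    by apply: rA; apply: le_ball tt'; rewrite ler_pdivrMr// ler_pMr// ler1n.
  have [_ h1] := AB (s, z') (conj (rA _ ts) Bz') (seg s sa).
  have [_ h2] := AB (t', z') (conj At' Bz') (seg t' ta').
  rewrite -(subrKA (velocity t i j z)) (le_lt_trans (ler_normD _ _))//.
  have -> : e%:C = (e / 2)%:C + (e / 2)%:C by rewrite -rmorphD -splitr.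
  by apply: ltrD; [rewrite distrC; exact: h1|exact: h2].
move=> /(_ _ _ P _ H) => nP; apply: filterS nP => d Pd s t z sa ta std Kz.
by apply: (Pd (t, z)) => //; split=> //=; rewrite in_itv.
Qed.

End MaximalTime.

(** * No solution exists beyond time 1/n *)

Section Contradiction.
Variables (R : realType) (n : nat) (alpha : 'rV[R[i]]_n).
Hypothesis halpha : hopf_param alpha.
Hypothesis n2 : (2 <= n)%N.
Local Notation C := R[i].
Local Notation Cn := 'rV[R[i]]_n.
Local Notation Re := (@complex.Re R).
Local Notation Im := (@complex.Im R).
Local Notation M := (hopf_manifold halpha).
Local Notation U0 := (@Cn0 R n).
Local Notation oU := (@open_Cn0 R n).
Local Notation T := (n%:R^-1 : R).
Variables (T' : \bar R) (g : R -> coefs M).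
Hypothesis flow_g : chern_ricci_flow (omegaH halpha) T' g.
Local Notation I := (time_interval T').
Local Notation G := (@flow_mx R n alpha halpha g).
Local Notation vel := (@velocity R n alpha halpha g).
Local Notation pot := (@potential R n alpha halpha g).

Lemma cvgC_sum (X : Type) (F : set_system X) (FF : Filter F) (J : Type) (r : seq J)
    (f : J -> X -> C) (a : J -> C) :
  (forall j, f j @ F --> a j) ->
  (fun x => \sum_(j <- r) f j x) @ F --> \sum_(j <- r) a j.
Proof.
move=> fa; elim: r => [|j r IH].
  rewrite big_nil; apply: (cvgC_ext _ (cvgC_cst 0)).
  by near=> x; rewrite big_nil.
rewrite big_cons; apply: (cvgC_ext _ (cvgC_D (fa j) IH)).
by near=> x; rewrite big_cons.
Unshelve. all: by end_near. Qed.

Lemma time_interval_le (a t : R) : (a%:E < T')%E -> 0 <= t -> t <= a -> I t.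
Proof. by move=> aT t0 ta; split=> //; apply: le_lt_trans aT; rewrite lee_fin. Qed.

Lemma flow_step (a s t e : R) (z : Cn) i j : (a%:E < T')%E -> z != 0 ->
  0 <= s -> s <= t -> t <= a ->
  (forall x, s <= x <= t -> `|vel x i j z - vel s i j z| <= e%:C) ->
  `|G t z i j - G s z i j - (t - s)%:C * vel s i j z| <= (2 * e * (t - s))%:C.
Proof.
move=> aT z0 s0 st ta He.
have Ix x : s <= x -> x <= t -> I x.
  by move=> sx xt; apply: (time_interval_le aT); [exact: le_trans sx|exact: le_trans ta].
apply: (@mean_value R (fun x => G x z i j) (fun x => vel x i j z)) => //.
- move=> x; rewrite in_itv /= => /andP[sx xt].
  have H := has_rder_flow flow_g (i := i) (j := j) (Ix x (ltW sx) (ltW xt)) z0.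
  move: H; rewrite /has_rder within_setT_dnbhs.
  by rewrite (time_interior (Ix x (ltW sx) (ltW xt)) (le_lt_trans s0 sx)).
- apply/subspace_continuousP => x; rewrite /= in_itv /= => /andP[sx xt].
  apply/cvgCP => d d0.
  have H := flow_time_continuous flow_g i j (Ix x sx xt) z0 d0.
  suff : \forall y \near x, `[s, t]%classic y -> `|G x z i j - G y z i j| < d%:C by [].
  apply: filterS H => y Hy; rewrite /= in_itv /= => /andP[sy yt].
  by apply: Hy; exact: Ix.
- by move=> x; rewrite in_itv /= => /andP[sx xt]; apply: He; rewrite !ltW.
Qed.

(** Telescoping sum of the mean value inequality over the N subintervals of
    length h, on each of which dg/dt varies by less than e. *)
Lemma flow_riemann (h d e : R) (N : nat) (z : Cn) i j :
  ((N%:R * h)%:E < T')%E -> z != 0 -> 0 <= h -> h < d -> 0 <= e ->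
  (forall s t, 0 <= s <= N%:R * h -> 0 <= t <= N%:R * h -> `|s - t| < d ->
    `|vel s i j z - vel t i j z| < e%:C) ->
  `|G (N%:R * h) z i j - G 0 z i j - \sum_(k < N) h%:C * vel (k%:R * h) i j z|
    <= (2 * e * (N%:R * h))%:C.
Proof.
move=> aT z0 h0 hd e0 He.
suff H m : (m <= N)%N ->
    `|G (m%:R * h) z i j - G 0 z i j - \sum_(k < m) h%:C * vel (k%:R * h) i j z|
    <= (2 * e * (m%:R * h))%:C by exact: H.
elim: m => [_|m IH mN].
  by rewrite big_ord0 mul0r subrr subr0 normr0 mulr0.
have mhN : m.+1%:R * h <= N%:R * h by rewrite ler_wpM2r// ler_nat.
have mh0 : 0 <= m%:R * h by rewrite mulr_ge0.
have mE : m.+1%:R * h = m%:R * h + h by rewrite -addn1 natrD mulrDl mul1r.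
have mle : m%:R * h <= m.+1%:R * h by rewrite mE lerDl.
have step := @flow_step _ (m%:R * h) (m.+1%:R * h) e z i j aT z0 mh0 mle mhN.
rewrite big_ord_recr /=.
have hE : m.+1%:R * h - m%:R * h = h by rewrite mE addrC addKr.
rewrite hE in step.
have gen (p q r s t w : C) : p - r - (t + w * s) = (q - r - t) + (p - q - w * s).
  by ring.
rewrite (gen _ (G (m%:R * h) z i j)).
apply: le_trans (ler_normD _ _) _.
have -> : (2 * e * (m.+1%:R * h))%:C =
    (2 * e * (m%:R * h))%:C + (2 * e * h)%:C :> C.
  by rewrite mE -rmorphD -mulrDr.
apply: lerD; first exact: IH (ltnW mN).
apply: step => x /andP[sx xt]; apply/ltW/He.
- by rewrite (le_trans mh0 sx) (le_trans xt).
- by rewrite mh0 (le_trans mle).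
- by rewrite ger0_norm ?subr_ge0// (le_lt_trans _ hd)// lerBlDl -mE.
Qed.

Lemma quad_flow_continuous (t : R) (z v : Cn) : I t -> z != 0 ->
  (fun p : Cn * Cn => Re (\sum_i \sum_j p.2 0 i * G t p.1 i j * Num.conj (p.2 0 j)))
    @ (z, v) --> Re (\sum_i \sum_j v 0 i * G t z i j * Num.conj (v 0 j)).
Proof.
move=> It z0.
have cv i : (fun p : Cn * Cn => p.2 0 i) @ (z, v) --> v 0 i.
  apply: (@cvg_comp _ _ _ snd (fun w : Cn => w 0 i) _ (nbhs v)).
    exact: (@cvg_snd _ _ (nbhs z) (nbhs v)).
  exact: coord_continuous.
apply: (@cvg_comp _ _ _ (fun p : Cn * Cn => \sum_i \sum_j p.2 0 i * G t p.1 i j * Num.conj (p.2 0 j))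
  Re _ (nbhs (\sum_i \sum_j v 0 i * G t z i j * Num.conj (v 0 j)))); last exact: continuous_Re.
apply: cvgC_sum => i; apply: cvgC_sum => j.
apply: cvgC_M; last first.
  apply: (@cvg_comp _ _ _ (fun p : Cn * Cn => p.2 0 j) Num.conj _ (nbhs (v 0 j))).
    exact: cv.
  exact: continuous_conj.
apply: cvgC_M; first exact: cv.
apply: (@cvg_comp _ _ _ fst (fun w : Cn => G t w i j) _ (nbhs z)).
  exact: (@cvg_fst _ _ (nbhs z) (nbhs v)).
exact: (Ck_cont (Ck_flow flow_g i j 0 It)).
Qed.

Lemma quad_flow_gt0 (t : R) (z v : Cn) : I t -> z != 0 -> v != 0 ->
  0 < Re (\sum_i \sum_j v 0 i * G t z i j * Num.conj (v 0 j)).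
Proof.
move=> It z0 v0; have [_ /(_ v v0)] := flow_posdef flow_g It z0.
by rewrite quad_formE => /gt0_complex_real[].
Qed.

(** A positive continuous function on a compact set, namely on pairs of a point of
    the shell and a unit vector. *)
Lemma quad_flow_lower (t b : R) : I t -> 1 <= b -> exists2 m : R, 0 < m &
  forall z v, shell 1 b z -> shell 1 1 v ->
    m <= Re (\sum_i \sum_j v 0 i * G t z i j * Num.conj (v 0 j)).
Proof.
move=> It b1; pose S : set (Cn * Cn) := shell 1 b `*` shell 1 1.
have cS : compact S by apply: compact_setX; exact: compact_shell.
have [v0 v0S _] := @null_unit_vector R n 0 n2.
have S0 : S !=set0.
  exists (v0, v0); split=> //=; move: v0S; rewrite /shell /= => /andP[-> h1] /=.
  exact: le_trans h1 b1.
have cq : {within S, continuous (fun p : Cn * Cn =>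
    Re (\sum_i \sum_j p.2 0 i * G t p.1 i j * Num.conj (p.2 0 j)))}.
  apply: continuous_in_subspaceT => -[z v] /set_mem[/= zK vS].
  exact: quad_flow_continuous It (shell_neq0 ltr01 zK).
have [[z v] /set_mem[/= zK vS] zmin] := compact_EVT_min S0 cS cq.
exists (Re (\sum_i \sum_j v 0 i * G t z i j * Num.conj (v 0 j))).
  by apply: quad_flow_gt0 => //; [exact: shell_neq0 ltr01 zK|exact: shell_neq0 ltr01 vS].
by move=> z' v' zK' vS'; exact: (zmin (z', v') (mem_set (conj zK' vS'))).
Qed.

Lemma quad_form_le (A : 'I_n -> 'I_n -> C) (v : Cn) (e : R) : shell 1 1 v ->
  (forall i j, `|A i j| <= e%:C) ->
  Re (\sum_i \sum_j v 0 i * A i j * Num.conj (v 0 j)) <= n%:R * (n%:R * e).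
Proof.
move=> /andP[_ v1] Ae.
have vi i : `|v 0 i| <= 1.
  rewrite -[X in X <= _]RRe_real ?normr_real// -(rmorph1 (real_complex R)) lecR.
  exact: norm_coord_le.
have e0 (i j : 'I_n) : 0 <= e%:C :> C by rewrite (le_trans _ (Ae i j)) ?normr_ge0.
set z := \sum_i _; rewrite (le_trans (ler_norm _))// (le_trans (norm_Re_le _))//.
rewrite -lecR RRe_real ?normr_real//.
apply: (@le_trans _ _ (\sum_(i < n) \sum_(j < n) e%:C)); last first.
  have -> : \sum_(i < n) \sum_(j < n) e%:C = n%:R * (n%:R * e%:C) :> C.
    rewrite sumr_const card_ord -[LHS]mulr_natl; congr (_ * _).
    by rewrite sumr_const card_ord -[LHS]mulr_natl.
  by rewrite rmorphM rmorphM /= rmorph_nat.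
rewrite (le_trans (ler_norm_sum _ _ _))// ler_sum// => i _.
rewrite (le_trans (ler_norm_sum _ _ _))// ler_sum// => j _.
rewrite !normrM norm_conjC -[leRHS]mulr1 ler_pM ?mulr_ge0//.
by rewrite -[leRHS]mul1r ler_pM.
Qed.

Lemma velocity_unif_all (a : R) (K : set Cn) (e : R) : (a%:E < T')%E ->
  compact K -> K `<=` U0 -> 0 < e ->
  exists2 d : R, 0 < d & forall i j s t z, 0 <= s <= a -> 0 <= t <= a ->
    `|s - t| < d -> K z -> `|vel s i j z - vel t i j z| < e%:C.
Proof.
move=> aT cK KU e0.
have : \forall d \near (0 : R), forall i j s t z, 0 <= s <= a -> 0 <= t <= a ->
    `|s - t| < d -> K z -> `|vel s i j z - vel t i j z| < e%:C.
  have H := @filter_forall _ _ _ _ (nbhs_filter (0 : R)) (fun p : 'I_n * 'I_n =>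
    velocity_unif flow_g p.1 p.2 aT cK KU e0).
  by apply: filterS H => r Hr i j; exact: (Hr (i, j)).
move=> /nbhs_ballP[r /= r0 rP]; exists (r / 2); first by rewrite divr_gt0.
apply: rP; rewrite /ball/= sub0r normrN gtr0_norm ?divr_gt0//.
by rewrite ltr_pdivrMr// ltr_pMr// ltr1n.
Qed.

Lemma flow_start (z : Cn) i j : z != 0 -> (T%:E < T')%E ->
  G 0 z i j = conformal i j z.
Proof.
move=> z0 TT'; have [c cz] := chart_ex halpha z0; have [_ _ _ start] := flow_g.
have I0 : I 0 by apply: (time_interval_le TT').
by rewrite (flow_mxE flow_g I0 cz) (start c z cz) mxE.
Qed.

(** If g exists at T = 1/n, then at a maximum p of the Riemann sum phi of the
    potential, and on a unit vector v on which omega_T vanishes at p, the value of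
    g(T) is at most the error of the Riemann sum; the mesh is chosen so that this
    is less than the lower bound m. *)
Lemma no_flow_beyond : (T%:E < T')%E -> False.
Proof.
move=> TT'; have nR : 0 < (n%:R : R) by rewrite ltr0n (ltn_trans _ n2).
have T0 : 0 < T by rewrite invr_gt0.
have IT : I T by apply: (time_interval_le TT') => //; exact: ltW.
have [b b1 bP] := fundamental_shell halpha.
pose K : set Cn := shell 1 b; have cK : compact K by exact: compact_shell.
have KU : K `<=` U0 by move=> z; exact: shell_neq0 ltr01.
have [m m0 mP] := quad_flow_lower IT b1.
(* the error of the Riemann sum is 2 e T for each coefficient, and the n^2
   coefficients contribute 2 e T n^2 = m / 2 *)
pose e := m / (4 * (T * (n%:R * n%:R))).
have e0 : 0 < e by rewrite divr_gt0 ?mulr_gt0.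
have [d d0 dP] := velocity_unif_all TT' cK KU e0.
(* the successor makes N positive *)
pose N := (Num.bound (T / d)).+1; pose h := T / N%:R.
have N0 : 0 < (N%:R : R) by rewrite ltr0n.
have Nh : N%:R * h = T by rewrite /h mulrC divfK ?gt_eqF.
have h0 : 0 < h by rewrite divr_gt0.
have hd : h < d.
  rewrite /h ltr_pdivrMr// mulrC -ltr_pdivrMr//.
  rewrite (lt_trans (archi_boundP _)) ?ltr_nat//.
  by rewrite divr_ge0// ltW.
have It (k : 'I_N) : I (k%:R * h).
  apply: (time_interval_le TT'); first exact: mulr_ge0 (ler0n _ _) (ltW h0).
  by rewrite -Nh (ler_wpM2r (ltW h0))// ler_nat ltnW.
pose phi (z : Cn) : C := \sum_(k < N) h%:C * pot (k%:R * h) z.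
have CF l (k : 'I_N) : Ck U0 l (pot (k%:R * h)) by exact: (Ck_potential flow_g l (It k)).
have Cphi : Ck U0 2 phi := Ck_lincomb oU (index_enum _) (fun _ => h%:C) (CF 2%N).
have rphi : real_valued U0 phi.
  move=> z _; rewrite /phi; elim/big_rec: _ => [//|k y _ y0].
  by rewrite ImD y0 addr0 Im_rM /= mulr0.
have phi_act k z : z != 0 -> phi (alpha_act alpha k z) = phi z.
  by move=> z0; apply: eq_bigr => l _; rewrite (potential_act flow_g k (It l) z0).
have [p Kp pmax] : exists2 p, K p & forall w, w != 0 -> Re (phi w) <= Re (phi p).
  have K0 : K !=set0.
    have [w + _] := @null_unit_vector R n 0 n2; move=> wS.
    by have [k wK] := bP w (shell_neq0 ltr01 wS); exists (alpha_act alpha k w).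
  have cphi : {within K, continuous (fun z => Re (phi z))}.
    apply: continuous_in_subspaceT => z /set_mem Kz.
    apply: (@cvg_comp _ _ _ phi Re _ (nbhs (phi z))); last exact: continuous_Re.
    exact: (Ck_cont Cphi (KU z Kz)).
  have [p /set_mem Kp pmax] := compact_EVT_max K0 cK cphi.
  exists p => // w w0; have [k wK] := bP w w0.
  by rewrite -(phi_act k w w0); exact: pmax (mem_set wK).
have p0 := KU p Kp.
have [v vS vp] := null_unit_vector p n2.
pose X i j : C := dz i (dzbar j phi) p.
pose E i j : C := G T p i j - G 0 p i j - \sum_(k < N) h%:C * vel (k%:R * h) i j p.
have E_le i j : `|E i j| <= (2 * e * T)%:C.
  have NhT : ((N%:R * h)%:E < T')%E by rewrite Nh.
  have := flow_riemann (i := i) (j := j) NhT p0 (ltW h0) hd (ltW e0).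
  by rewrite Nh; apply => s t sT tT st; exact: dP.
(* omega_H + T (drift) = omega_T *)
have GE i j : G T p i j = E i j + rank1 i j p + X i j.
  have XE : X i j = \sum_(k < N) h%:C * dz i (dzbar j (pot (k%:R * h))) p.
    exact: (levi_lincomb oU (index_enum _) (fun _ => h%:C) i j (CF 2%N) p0).
  have velE : \sum_(k < N) h%:C * vel (k%:R * h) i j p =
      X i j + (rank1 i j p - conformal i j p).
    rewrite XE /velocity; under eq_bigr do rewrite mulrDr.
    rewrite big_split /=; congr (_ + _).
    rewrite sumr_const card_ord -mulr_natl mulrA.
    have -> : N%:R * h%:C = n%:R^-1 :> C.
      by rewrite -(rmorph_nat (real_complex R) N) -rmorphM /= Nh fmorphV rmorph_nat.
    by rewrite /drift mulrA mulVf ?mul1r// pnatr_eq0 -lt0n (ltn_trans _ n2).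
  rewrite /E velE (flow_start i j p0 TT').
  move: (X i j) (rank1 i j p) (conformal i j p) (G T p i j) => x r q y; ring.
(* the omega_T term vanishes on v *)
have quadE : \sum_i \sum_j v 0 i * G T p i j * Num.conj (v 0 j) =
    \sum_i \sum_j v 0 i * E i j * Num.conj (v 0 j) +
    \sum_i \sum_j v 0 i * Num.conj (v 0 j) * X i j.
  have r0 : \sum_i \sum_j v 0 i * rank1 i j p * Num.conj (v 0 j) = 0.
    by rewrite quad_rank1 vp normr0 expr0n mul0r.
  rewrite -[RHS]addr0 -[X in _ = _ + X]r0 -!big_split /=; apply: eq_bigr => i _.
  rewrite -!big_split /=; apply: eq_bigr => j _; rewrite GE.
  by move: (E i j) (X i j) (rank1 i j p) => x y r; ring.
have := mP p v Kp vS; rewrite quadE ReD leNgt => /negP; apply.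
apply: (@le_lt_trans _ _ (n%:R * (n%:R * (2 * e * T)) + 0)).
  apply: lerD; first exact: quad_form_le vS E_le.
  exact: (levi_form_max oU v Cphi rphi p0 pmax).
rewrite addr0 (_ : _ * _ = m / 2); last first.
  by rewrite /e; field; rewrite gt_eqF.
by rewrite ltr_pdivrMr// ltr_pMr// ltr1n.
Qed.

End Contradiction.

Theorem proposition1p8 (R : realType) (n : nat) (hn : (2 <= n)%N)
    (alpha : 'rV[R[i]%C]_n) (halpha : hopf_param alpha) :
  let omega := hopf_flow halpha in
  let T : R := n%:R^-1 in
  [/\ chern_ricci_flow (omegaH halpha) T%:E omega,
      is_max_existence_time (omegaH halpha) T%:E,
      smooth_cvg_left omega T (omegaT halpha) &
      nonneg_form (omegaT halpha)].
Proof.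
have n0 : (0 < n)%N by exact: ltn_trans hn.
move=> omega T; have sol := hopf_flow_solution halpha n0; split.
- exact: sol.
- split.
  + by rewrite lte_fin invr_gt0 ltr0n.
  + by exists omega; exact: sol.
  + move=> T' g flow_g; rewrite leNgt; apply/negP.
    exact: (no_flow_beyond hn flow_g).
- exact: hopf_flow_cvg.
- exact: omegaT_form.
Qed.
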